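(* Let $D$ be an ADDB-domain with quotient field $K$, and let $A$ be a $D$-algebra that is torsion-free and finitely generated as a $D$-module, and such that $A\cap K=D$. Suppose that $\mathrm{Int}_K(A)_P=\mathrm{Int}_K(A_P)$ for all prime ideals $P$ of $D$. If $\mathrm{Int}_K(A)$ is integrally closed, then $\mathrm{Int}_K(A)$ is a Prüfer domain.
   Context: Algebras are associative and unital, not necessarily commutative. $K$ and $A$ are embedded in $B=A\otimes_D K=(D\setminus\{0\})^{-1}A$ via $k\mapsto 1\otimes k$ and $a\mapsto a\otimes 1$; $A\cap K=D$ is meant inside $B$. ADDB-domain: an integral domain $D$, not a field, is an almost Dedekind domain if $D_M$ is a discrete valuation ring for each maximal ideal $M$. Let $D$ be almost Dedekind with all residue fields finite. Then $D$ contains a principal ideal domain $D_0$, where $D_0\cong\mathbb{Z}$ if $\mathrm{char}(K)=0$, and $D_0\cong F[t]$ (polynomial ring in one variable over the prime field $F$ with $\mathrm{char}(K)$ elements) if $\mathrm{char}(K)>0$. For a nonzero prime element $p$ of $D_0$ and a prime $P$ of $D$ above $p$ (i.e. $P\cap D_0=pD_0$), let $e_{P,p}=v_P(p)$, with $v_P$ the normalized $P$-adic valuation on $K$, and $f_{P,p}=[D/P:D_0/pD_0]$. $D$ satisfies the double-boundedness condition if, for each $p$, the sets $\{e_{P,p}\}$ and $\{f_{P,p}\}$ ($P$ ranging over the primes of $D$ above $p$) are both bounded. $D$ is an ADDB-domain if it is an almost Dedekind domain with finite residue fields satisfying the double-boundedness condition. $\mathrm{Int}_K(A)=\{f\in K[X]\mid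 f(A)\subseteq A\}$. For a prime ideal $P$ of $D$ and a $D$-module $M$, $M_P=(D\setminus P)^{-1}M$; $\mathrm{Int}_K(A_P)=\{f\in K[X]\mid f(A_P)\subseteq A_P\}$, with $A_P\subseteq B$. *)

(* Defs.v *)
From HB Require Import structures.
From mathcomp Require Import all_boot all_order all_algebra.
From mathcomp Require Import ring_quotient.
From mathcomp Require Import boolp classical_sets cardinality.

Set Implicit Arguments.
Unset Strict Implicit.
Unset Printing Implicit Defensive.

Import Order.TTheory GRing.Theory Num.Theory.
Local Open Scope ring_scope.
Local Open Scope classical_set_scope.
Local Open Scope quotient_scope.

Notation tofrac := (@FracField.tofrac _).
Notation "x %:F" := (@FracField.tofrac _ x) : ring_scope.

(* The localization at P of a D-submodule M of a K-vector space, K = Frac D,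
   taken inside that space: { m / s | m in M, s in D \ P }. *)
Definition localize (D : idomainType) (P : {pred D})
    (V : lmodType {fraction D}) (M : set V) : set V :=
  [set v | exists s m, [/\ s \notin P, M m & v = s%:F^-1 *: m]].

Definition local_ring (D : idomainType) (P : {pred D}) : set {fraction D} :=
  localize P (range tofrac : set {fraction D}^o).

(* The value of v at 0 (morally +oo) is irrelevant. *)
Definition normalized_valuation (F : fieldType) (v : F -> int) : Prop :=
  [/\ forall x y, x != 0 -> y != 0 -> v (x * y) = v x + v y,
      forall x y, x != 0 -> y != 0 -> x + y != 0 ->
        Num.min (v x) (v y) <= v (x + y)
    & exists2 x, x != 0 & v x = 1].

Definition valuation_ring_of (F : fieldType) (v : F -> int) : set F :=
  [set x | x = 0 \/ 0 <= v x].

Definition dvr (F : fieldType) (O : set F) : Prop :=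
  exists2 v, normalized_valuation v & O = valuation_ring_of v.

(* [idealr D] is the library's type of proper ideals of D. *)
Definition maximal_ideal (D : idomainType) (M : idealr D) : Prop :=
  forall J : idealr D, {subset M <= J} -> {subset J <= M}.

Definition almost_dedekind (D : idomainType) : Prop :=
  (exists2 x : D, x != 0 & x \isn't a GRing.unit) /\
  (forall M : idealr D, maximal_ideal M -> dvr (local_ring M)).

Definition finite_residue_fields (D : idomainType) : Prop :=
  forall M : idealr D, maximal_ideal M -> finite_set [set: {ideal_quot M}].

Definition divides (R : idomainType) (a b : R) : Prop := exists c, b = c * a.

Definition prime_element (R : idomainType) (p : R) : Prop :=
  [/\ p != 0, p \isn't a GRing.unit
    & forall a b, divides p (a * b) -> divides p a \/ divides p b].

Section DoubleBoundedness.
Variables (D D0 : idomainType) (phi : {rmorphism D0 -> D}).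

Definition lies_above (P : prime_idealr D) (p : D0) : Prop :=
  forall c : D0, phi c \in P <-> divides p c.

Definition adic_valuation (P : prime_idealr D) (v : {fraction D} -> int) :=
  normalized_valuation v /\ local_ring P = valuation_ring_of v.

(* e_{P,p} = e *)
Definition ramification_index (P : prime_idealr D) (p : D0) (e : int) : Prop :=
  exists2 v, adic_valuation P v & v (phi p)%:F = e.

(* f_{P,p} = n: D/P has a basis of n elements over D0/pD0, whose elements
   are represented by elements of D0. *)
Definition residue_degree (P : prime_idealr D) (p : D0) (n : nat) : Prop :=
  exists b : 'I_n -> {ideal_quot P},
    (forall y : {ideal_quot P}, exists c : 'I_n -> D0,
        y = \sum_(i < n) \pi_{ideal_quot P} (phi (c i)) * b i) /\
    (forall c : 'I_n -> D0,
        \sum_(i < n) \pi_{ideal_quot P} (phi (c i)) * b i = 0 ->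
        forall i, divides p (c i)).

Definition doubly_bounded_over : Prop :=
  forall p : D0, prime_element p ->
    (exists N : int, forall (P : prime_idealr D) (e : int),
        lies_above P p -> ramification_index P p e -> e <= N) /\
    (exists N : nat, forall (P : prime_idealr D) (n : nat),
        lies_above P p -> residue_degree P p n -> (n <= N)%N).

End DoubleBoundedness.

(* In positive characteristic q, a copy of F_q[t] in D is not canonical; the
   condition is required for some copy. *)
Definition doubly_bounded (D : idomainType) : Prop :=
  ([pchar {fraction D}] =i pred0 /\
     exists phi : {rmorphism int -> D}, injective phi /\ doubly_bounded_over phi)
  \/
  (exists2 q : nat, q \in [pchar {fraction D}] &
     exists phi : {rmorphism {poly 'F_q} -> D},
       injective phi /\ doubly_bounded_over phi).

Definition ADDB_domain (D : idomainType) : Prop :=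
  [/\ almost_dedekind D, finite_residue_fields D & doubly_bounded D].

Definition torsion_free (D : idomainType) (V : lmodType D) : Prop :=
  forall (d : D) (x : V), d *: x = 0 -> d = 0 \/ x = 0.

Definition finitely_generated (D : idomainType) (V : lmodType D) : Prop :=
  exists (n : nat) (g : 'I_n -> V), forall x : V,
    exists c : 'I_n -> D, x = \sum_(i < n) c i *: g i.

(* iota exhibits the K-algebra B as (D \ {0})^-1 A, that is as the tensor
   product of A and K over D. *)
Definition is_scalar_localization (D : idomainType) (A : algType D)
    (B : algType {fraction D}) (iota : {rmorphism A -> B}) : Prop :=
  [/\ forall (d : D) (a : A), iota (d *: a) = d%:F *: iota a,
      forall a : A, iota a = 0 <-> exists2 d : D, d != 0 & d *: a = 0
    & forall b : B, exists (d : D) (a : A), d != 0 /\ b = d%:F^-1 *: iota a].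

Definition IntK (K : fieldType) (B : algType K) (S : set B) : set {poly K} :=
  [set f | forall b, S b -> S (horner_alg b f)].

Section IntRing.
Variables (D : idomainType) (A : algType D) (B : algType {fraction D}).
Variable iota : {rmorphism A -> B}.
Local Notation K := {fraction D}.

Definition IntK_pred : {pred {poly K}} := fun f => f \in IntK (range iota).

Lemma IntK_predP f :
  reflect (forall a, exists a', iota a' = horner_alg (iota a) f)
          (f \in IntK_pred).
Proof.
apply: (iffP idP) => [|fP].
  move=> /set_mem fP a; have Sa : range iota (iota a) by exists a.
  by have [a' _ aE] := fP _ Sa; exists a'.
by apply/mem_set => _ [a _ <-]; have [a' <-] := fP a; exists a'.
Qed.

Fact IntK_subring : subring_closed IntK_pred.
Proof.
split=> [|f g /IntK_predP fP /IntK_predP gP|f g /IntK_predP fP /IntK_predP gP].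
- by apply/IntK_predP => a; exists 1; rewrite !rmorph1.
- apply/IntK_predP => a; have [[x xE] [y yE]] := (fP a, gP a).
  by exists (x - y); rewrite !rmorphB xE yE.
- apply/IntK_predP => a; have [[x xE] [y yE]] := (fP a, gP a).
  by exists (x * y); rewrite !rmorphM xE yE.
Qed.

HB.instance Definition _ :=
  GRing.isSubringClosed.Build {poly K} IntK_pred IntK_subring.

(* Int_K(A) as a ring. *)
Record IntK_ring := MkIntK {
  IntK_val : {poly K};
  IntK_valP : IntK_val \in IntK_pred }.

HB.instance Definition _ := [isSub for IntK_val].
HB.instance Definition _ := [Choice of IntK_ring by <:].
HB.instance Definition _ := [SubChoice_isSubComNzRing of IntK_ring by <:].

Definition IntK_unit : {pred IntK_ring} :=
  fun f => (val f \is a GRing.unit) && ((val f)^-1 \in IntK_pred).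
Definition IntK_inv (f : IntK_ring) : IntK_ring :=
  if f \in IntK_unit then insubd f (val f)^-1 else f.

Fact IntK_mulVr : {in IntK_unit, left_inverse 1 IntK_inv *%R}.
Proof.
move=> f fU; rewrite /IntK_inv fU; have /andP[uf If] := fU.
by apply: val_inj; rewrite rmorphM /= val_insubd If mulVr ?rmorph1.
Qed.

Fact IntK_unitP (f g : IntK_ring) : g * f = 1 -> f \in IntK_unit.
Proof.
move=> /(congr1 val); rewrite rmorphM rmorph1 /= => gf1.
have uf : val f \is a GRing.unit by apply/unitrPr; exists (val g); rewrite mulrC.
have fV : (val f)^-1 = val g by rewrite -[LHS]mul1r -gf1 mulrK.
by apply/andP; split=> //; rewrite fV; exact: valP.
Qed.

Fact IntK_inv_out : {in [predC IntK_unit], IntK_inv =1 id}.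
Proof. by move=> f /negbTE fU; rewrite /IntK_inv fU. Qed.

HB.instance Definition _ := GRing.ComNzRing_hasMulInverse.Build IntK_ring
  IntK_mulVr IntK_unitP IntK_inv_out.

Fact IntK_integral (f g : IntK_ring) : f * g = 0 -> (f == 0) || (g == 0).
Proof.
move=> /(congr1 val); rewrite rmorphM rmorph0 /= => /eqP.
by rewrite mulf_eq0 -[0](rmorph0 (val : IntK_ring -> _)) !(inj_eq val_inj).
Qed.

HB.instance Definition _ :=
  GRing.ComUnitRing_isIntegral.Build IntK_ring IntK_integral.

End IntRing.

Definition integrally_closed (R : idomainType) : Prop :=
  forall x : {fraction R}, integralOver tofrac x -> exists r : R, x = r%:F.

Section Prufer.
Variable R : idomainType.
Local Notation Q := {fraction R}.

Definition fractional_ideal (J : set Q) : Prop :=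
  [/\ J 0, forall x y, J x -> J y -> J (x + y),
      forall (r : R) x, J x -> J (r%:F * x)
    & exists2 d : R, d != 0 & forall x, J x -> range tofrac (d%:F * x)].

Definition ideal_mul (I J : set Q) : set Q :=
  [set x | exists (n : nat) (u v : 'I_n -> Q),
     [/\ forall i, I (u i), forall i, J (v i) & x = \sum_(i < n) u i * v i]].

Definition invertible_ideal (I : set Q) : Prop :=
  exists2 J, fractional_ideal J & ideal_mul I J = range tofrac.

Definition ideal_gen (n : nat) (g : 'I_n -> R) : set Q :=
  [set x | exists c : 'I_n -> R, x = (\sum_(i < n) c i * g i)%:F].

Definition prufer_domain : Prop :=
  forall (n : nat) (g : 'I_n -> R), (exists i, g i != 0) ->
    invertible_ideal (ideal_gen g).

End Prufer.

(* Main.v *)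
Require Import Defs.
From mathcomp Require Import all_boot all_order all_algebra.
From mathcomp Require Import ring_quotient.
From mathcomp Require Import boolp classical_sets.
From HB Require Import structures.
From mathcomp Require Import all_field cardinality zify ring.

(* Fix a maximal ideal M of D and put V = D_M, a discrete valuation ring with
   uniformizer pi and finite residue field. Every element of A_M is killed by a
   monic polynomial over V of degree n, the number of generators of A.

   (1) As Int_K(A) is integrally closed, a polynomial f with f(a) integral over V
   for all a in A_M lies in Int_K(A)_M: if Phi is the product of all monic
   polynomials of degree n over V / pi, a power of Phi sends each f(a) into A_M,
   so f is integral over Int_K(A_M) = Int_K(A)_M. The integrality of f(a) is tested
   on the valuation rings O prolonging V to the fields K(alpha), for alpha a root
   of the characteristic polynomial of a.

   (2) Ramification indices and residue degrees of these O are at most n, so there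
   is T such that y^T is pi^l times a 1-unit for all O and all nonzero y. Given
   coprime g_i, a suitable form w in the g_i, of degree divisible by T, has the
   value of a power of the g_i of least value and is pi^l times a 1-unit with l
   bounded; a polynomial E with E(0) = 1 makes E(w) small in every O, and
   1 - E(w) = w W gives Y_i with sum Y_i g_i = 1 and all Y_i g_j integral on A_M.

   (3) By (1) some s outside M satisfies s Y_i g_j in Int_K(A) for all i, j.
   Letting M vary, such s generate the unit ideal of D, and the resulting Y_i
   generate the inverse of the ideal generated by the g_i. *)

Import Order.TTheory GRing.Theory Num.Theory.

Local Open Scope ring_scope.
Local Open Scope classical_set_scope.

Set Implicit Arguments.
Unset Strict Implicit.
Unset Printing Implicit Defensive.

(** * Valuation rings *)

Definition is_valuation_ring (L : fieldType) (O : {pred L}) : Prop :=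
  forall x, (x \in O) || (x^-1 \in O).

(** Dividing the monic equation of [z] by a power of [z] expresses [z] as a polynomial in [z^-1]
    over [O]. *)
Lemma integral_mem_of_inv (L : fieldType) (O : subringClosed L) (p : {poly L}) z :
  p \is monic -> p \is a polyOver O -> root p z -> z^-1 \in O -> z \in O.
Proof.
move=> pm pO /eqP pz zO.
have [->|z0] := eqVneq z 0; first exact: rpred0.
have p0 : (0 < size p)%N by rewrite size_poly_gt0 monic_neq0.
have {}p0 : (1 < size p)%N.
  rewrite ltn_neqAle p0 andbT eq_sym; apply/negP => /eqP s1.
  have := pz; rewrite horner_coef s1 big_ord1 expr0 mulr1 => c0.
  by have := monicP pm; rewrite lead_coefE s1 c0 => /eqP; rewrite eq_sym oner_eq0.
have [d sd] : exists d, size p = d.+2 by exists (size p).-2; case: (size p) p0 => [|[]].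
move: pz; rewrite horner_coef sd big_ord_recr /=.
have -> : p`_d.+1 = 1 by have := monicP pm; rewrite lead_coefE sd.
rewrite mul1r => /eqP; rewrite addrC addr_eq0 => /eqP pz.
have -> : z = - \sum_(i < d.+1) p`_i * z^-1 ^+ (d - i).
  rewrite -[LHS](mulfK (expf_neq0 d z0)) -exprS pz mulNr mulr_suml; congr (- _).
  apply: eq_bigr => i _; rewrite -mulrA; congr (_ * _).
  have ile : (i <= d)%N by rewrite -ltnS.
  by rewrite -{2}(subnK ile) exprD invfM mulrCA mulfV ?expf_neq0 // mulr1 exprVn.
rewrite rpredN rpred_sum // => i _; rewrite rpredM ?rpredX //.
by move/polyOverP: pO.
Qed.

Section ValuationRing.
Variables (L : fieldType) (O : subringClosed L).
Hypothesis Oval : is_valuation_ring O.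

(** For a valuation ring, a nonzero [x] with [x^-1] outside [O] lies in [O] automatically, so the
    predicate only speaks of [x^-1]. *)
Definition max_ideal : {pred L} := fun x => (x == 0) || (x^-1 \notin O).
Definition one_unit : {pred L} := fun x => x - 1 \in max_ideal.

Lemma max_idealE x : (x \in max_ideal) = (x == 0) || (x^-1 \notin O).
Proof. by []. Qed.

Lemma max_ideal_sub x : x \in max_ideal -> x \in O.
Proof.
rewrite max_idealE => /orP[/eqP->|]; first exact: rpred0.
by have /orP[//|->] := Oval x.
Qed.

Lemma max_ideal1 : (1 \in max_ideal) = false.
Proof. by rewrite max_idealE oner_eq0 invr1 rpred1. Qed.

Lemma max_idealM x y : x \in max_ideal -> y \in O -> x * y \in max_ideal.
Proof.
rewrite !max_idealE => /orP[/eqP->|xO] yO; first by rewrite mul0r eqxx.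
case: eqVneq => //=; rewrite mulf_eq0 negb_or => /andP[x0 y0].
apply: contra xO => xyO; have -> : x^-1 = y * (x * y)^-1 by field; rewrite x0 y0.
exact: rpredM.
Qed.

Fact max_ideal_zmod : zmod_closed max_ideal.
Proof.
have mD x y : x \in max_ideal -> y \in max_ideal -> x + y \in max_ideal.
  (* Of two nonzero elements one divides the other in [O]; call the divisor [y] and factor it out of
     the sum. *)
  wlog xy : x y / y == 0 \/ x / y \in O => [H mx my|mx my].
    have [y0|y0] := eqVneq y 0; first by apply: H => //; left; rewrite y0.
    have [x0|x0] := eqVneq x 0; first by rewrite addrC; apply: H => //; left; rewrite x0.
    have /orP[h|h] := Oval (x / y); first by apply: H => //; right.
    by rewrite addrC; apply: H => //; right; rewrite -[y / x]invf_div.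
  have [->|y0] := eqVneq y 0; first by rewrite addr0.
  case: xy => [/eqP y0'|xy]; first by rewrite y0' eqxx in y0.
  have -> : x + y = y * (1 + x / y) by field.
  by apply: max_idealM => //; rewrite rpredD ?rpred1.
split; first by rewrite max_idealE eqxx.
move=> x y mx my; apply: mD => //.
by rewrite -[- y]mulN1r mulrC; apply: max_idealM => //; rewrite rpredN1.
Qed.

HB.instance Definition _ :=
  GRing.isZmodClosed.Build L max_ideal max_ideal_zmod.

Lemma max_ideal_unit x : x \in O -> x \notin max_ideal -> x^-1 \in O.
Proof. by rewrite max_idealE negb_or negbK => _ /andP[]. Qed.

Lemma max_ideal_inv x : x != 0 -> (x^-1 \in O) = (x \notin max_ideal).
Proof. by rewrite max_idealE => /negPf->; rewrite negbK. Qed.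

Lemma val_ring_root n x : x ^+ n.+1 \in O -> x \in O.
Proof.
move=> xO; have /orP[//|xVO] := Oval x.
have [->|x0] := eqVneq x 0; first exact: rpred0.
have -> : x = x ^+ n.+1 * x^-1 ^+ n by rewrite exprS exprVn mulfK ?expf_neq0.
by rewrite rpredM // rpredX.
Qed.

Lemma max_idealX n x : x \in max_ideal -> x ^+ n.+1 \in max_ideal.
Proof. by move=> mx; rewrite exprS max_idealM ?rpredX ?max_ideal_sub. Qed.

Lemma one_unitP x : reflect (exists2 y, y \in max_ideal & x = 1 + y) (x \in one_unit).
Proof.
apply: (iffP idP) => [h|[y my ->]]; last by rewrite /one_unit unfold_in addrC addKr.
by exists (x - 1) => //; rewrite addrC subrK.
Qed.

Lemma one_unit_sub x : x \in one_unit -> x \in O.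
Proof. by move=> /one_unitP[y my ->]; rewrite rpredD ?rpred1 ?max_ideal_sub. Qed.

Lemma one_unit_notin x : x \in one_unit -> x \notin max_ideal.
Proof.
move=> /one_unitP[y my ->]; apply/negP => h.
by have := rpredB h my; rewrite addrK max_ideal1.
Qed.

Lemma one_unit_neq0 x : x \in one_unit -> x != 0.
Proof. by move=> /one_unit_notin; rewrite max_idealE negb_or => /andP[]. Qed.

Lemma one_unit1 : 1 \in one_unit.
Proof. by rewrite /one_unit unfold_in subrr rpred0. Qed.

Lemma one_unitV x : x \in one_unit -> x^-1 \in one_unit.
Proof.
move=> hx; have x0 := one_unit_neq0 hx.
have xO : x^-1 \in O by rewrite max_ideal_inv ?one_unit_notin.
rewrite /one_unit unfold_in; have -> : x^-1 - 1 = - ((x - 1) * x^-1) by field.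
by rewrite rpredN max_idealM.
Qed.

Lemma one_unitM x y : x \in one_unit -> y \in one_unit -> x * y \in one_unit.
Proof.
move=> hx hy; rewrite /one_unit unfold_in.
have -> : x * y - 1 = (x - 1) * y + (y - 1) by ring.
by rewrite rpredD ?max_idealM ?one_unit_sub.
Qed.

Lemma one_unitX n x : x \in one_unit -> x ^+ n \in one_unit.
Proof.
by move=> hx; elim: n => [|n IH]; rewrite ?expr0 ?one_unit1 // exprS one_unitM.
Qed.

(** Divisibility in [O] is total, so a term of least value is found by comparing each new term with
    the best one so far. *)
Lemma dominant_term r (t : nat -> L) i : (i < r)%N -> t i != 0 ->
  exists j, [/\ (j < r)%N, t j != 0 & forall k, (k < r)%N -> t k / t j \in O].
Proof.
elim: r i => // r IH i ir ti.
have [[k [kr tk]]|none] := pselect (exists k, (k < r)%N /\ t k != 0); last first.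
  have {ir} ir : i = r.
    by move: ir; rewrite ltnS leq_eqVlt => /orP[/eqP//|ir]; case: none; exists i.
  exists r; split; rewrite -?ir // => k; rewrite ltnS leq_eqVlt => /orP[/eqP->|kr].
    by rewrite divff ?rpred1.
  have [->|tk] := eqVneq (t k) 0; first by rewrite mul0r rpred0.
  by case: none; exists k; rewrite -ir.
have [j [jr tj hj]] := IH _ kr tk.
have [trj|[tjr tr]] : t r / t j \in O \/ (t r / t j)^-1 \in O /\ t r != 0.
- have [->|tr] := eqVneq (t r) 0; first by left; rewrite mul0r rpred0.
  by have /orP[] := Oval (t r / t j); [left|right].
- exists j; split=> // [|l]; first exact: ltnW.
  by rewrite ltnS leq_eqVlt => /orP[/eqP->|] //; exact: hj.
exists r; split=> // l; rewrite ltnS leq_eqVlt => /orP[/eqP->|lr].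
  by rewrite divff ?rpred1.
have -> : t l / t r = t l / t j * (t r / t j)^-1 by field; rewrite tj tr.
by rewrite rpredM ?hj.
Qed.

Lemma val_ring_integral (p : {poly L}) z :
  p \is monic -> p \is a polyOver O -> root p z -> z \in O.
Proof.
by move=> pm pO pz; have /orP[//|] := Oval z; exact: integral_mem_of_inv pm pO pz.
Qed.

Lemma max_ideal0 : 0 \in max_ideal. Proof. exact: rpred0. Qed.

Lemma max_idealN x : (- x \in max_ideal) = (x \in max_ideal).
Proof. exact: rpredN. Qed.

Lemma max_idealD x y : x \in max_ideal -> y \in max_ideal -> x + y \in max_ideal.
Proof. exact: rpredD. Qed.

Lemma max_ideal_sum (I : Type) (r : seq I) (P : pred I) (F : I -> L) :
  (forall i, P i -> F i \in max_ideal) -> \sum_(i <- r | P i) F i \in max_ideal.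
Proof. exact: rpred_sum. Qed.

End ValuationRing.

Lemma char_poly_polyOver (L : fieldType) (O : subringClosed L) n (M : 'M[L]_n) :
  (forall i j, M i j \in O) -> char_poly M \is a polyOver O.
Proof.
move=> MO; rewrite /char_poly /determinant rpred_sum // => s _.
rewrite rpredM ?rpredX ?rpredN1 // rpred_prod // => i _.
by rewrite !mxE rpredB ?rpredMn ?polyOverX ?polyOverC.
Qed.

(** The [O]-module spanned by 1, x, ..., x^N is stable under [z]: z x^i is expanded by [p] for small
    i and by [q] for large i. Hence [z] is an eigenvalue of a matrix over [O]. *)
Lemma integral_of_horner_both (L : fieldType) (O : subringClosed L)
    (p q : {poly L}) (x z : L) :
  x != 0 -> p \is a polyOver O -> q \is a polyOver O ->
  z = p.[x] -> z = q.[x^-1] ->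
  exists r, [/\ r \is monic, r \is a polyOver O & root r z].
Proof.
move=> x0 pO qO zp zq.
(* From i = l on, the expansion by [q] has no negative powers of x; N leaves room for p(x) x^i with
   i < l. *)
pose l := size q; pose N := (size p + l)%N.
pose M : 'M[L]_N.+1 := \matrix_(i, k)
  (if (i < l)%N then (if (i <= k)%N then p`_(k - i) else 0)
   else (if (k <= i)%N then q`_(i - k) else 0)).
have MO i j : M^T i j \in O.
  rewrite !mxE; move/polyOverP: pO => pO; move/polyOverP: qO => qO.
  by do 2 case: ifP => _; rewrite ?rpred0.
exists (char_poly M^T); split; [exact: char_poly_monic|exact: char_poly_polyOver|].
rewrite -eigenvalue_root_char; apply/eigenvalueP.
exists (\row_i x ^+ i); last first.
  by apply/negP => /eqP /rowP /(_ ord0) /eqP; rewrite !mxE expr0 oner_eq0.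
apply/rowP => i; rewrite !mxE; under eq_bigr do rewrite !mxE.
have [il|il] := ltnP i l.
- rewrite -(big_mkord xpredT
    (fun k => x ^+ k * (if (i <= k)%N then p`_(k - i) else 0))).
  have iN : (i <= N.+1)%N by apply: ltnW.
  rewrite (big_cat_nat (n := i)) //= big_nat_cond big1 ?add0r; last first.
    by move=> k /andP[/andP[_ ki] _]; rewrite leqNgt ki mulr0.
  rewrite zp (horner_coef_wide (n := (N.+1 - i)%N)); last first.
    by rewrite leq_subRL // addnC /N ltnW // ltnS leq_add2l ltnW.
  rewrite mulr_suml -{1}[nat_of_ord i]add0n big_addn big_mkord; apply: eq_bigr => k _.
  by rewrite leq_addl addnK exprD mulrC mulrA.
- rewrite -(big_mkord xpredT
    (fun k => x ^+ k * (if (k <= i)%N then q`_(i - k) else 0))).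
  have iN : (i.+1 <= N.+1)%N by [].
  rewrite (big_cat_nat (n := i.+1)) //= [X in _ + X]big_nat_cond.
  rewrite [X in _ + X]big1 ?addr0; last first.
    by move=> k /andP[/andP[ki _] _]; rewrite leqNgt ki mulr0.
  rewrite zq (horner_coef_wide (n := i.+1)); last by rewrite ltnW.
  rewrite big_mkord mulr_suml (reindex_inj rev_ord_inj) /=; apply: eq_bigr => k _.
  have ki : (k <= i)%N by rewrite -ltnS.
  rewrite subSS leq_subr subKn // [in RHS]mulrAC -mulrA [RHS]mulrC; congr (_ * _).
  have -> : x ^+ i = x ^+ (i - k) * x ^+ k by rewrite -exprD subnK.
  by rewrite exprVn mulfK ?expf_neq0.
Qed.

(** Zorn's lemma gives a subring maximal among those containing [R0] and [z^-1] but not [z]. If it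
    missed both x and x^-1, adjoining either would capture [z]; then [z] would be integral over it,
    hence a member, since [z^-1] is one. *)
Lemma valuation_ring_avoiding (L : fieldType) (R0 : subringClosed L) (z : L) :
  ~ (exists p, [/\ p \is monic, p \is a polyOver R0 & root p z]) ->
  exists O : subringClosed L,
    [/\ is_valuation_ring O, {subset R0 <= O} & z \notin O].
Proof.
move=> zint.
have z0 : z != 0.
  apply/negP => /eqP z0; apply: zint; exists 'X.
  by rewrite monicX polyOverX z0 rootX eqxx.
pose sub (A : set L) := [/\ [/\ A 1, forall x y, A x -> A y -> A (x - y)
   & forall x y, A x -> A y -> A (x * y)], forall x, x \in R0 -> A x, A z^-1 & ~ A z].
pose A0 : set L := [set y | exists2 p, p \is a polyOver R0 & y = p.[z^-1]].
have subA0 : sub A0.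
  split.
  - split; first by exists 1; rewrite ?rpred1 ?hornerC.
      by move=> _ _ [p pR ->] [q qR ->]; exists (p - q); rewrite ?rpredB ?hornerD ?hornerN.
    by move=> _ _ [p pR ->] [q qR ->]; exists (p * q); rewrite ?rpredM ?hornerM.
  - by move=> x xR; exists x%:P; rewrite ?polyOverC ?hornerC.
  - by exists 'X; rewrite ?polyOverX ?hornerX.
  (* Multiplied by z^d, the relation z = p(z^-1) becomes a monic equation of degree d + 1 over
     [R0]. *)
  move=> [p pR zp]; apply: zint.
  pose d := size p; pose r : {poly L} := \sum_(i < d) p`_i *: 'X^(d - i).
  have sr : (size r < d.+2)%N.
    rewrite ltnS (leq_trans (size_sum _ _ _)) //.
    apply/bigmax_leqP => i _; rewrite (leq_trans (size_scale_leq _ _)) //.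
    by rewrite size_polyXn ltnS leq_subr.
  exists ('X^(d.+1) - r); split.
  - by rewrite monicE lead_coefDl ?size_polyN ?size_polyXn // lead_coefXn.
  - rewrite rpredB ?rpredX ?polyOverX // rpred_sum // => i _.
    by rewrite polyOverZ ?rpredX ?polyOverX //; move/polyOverP: pR.
  rewrite /root hornerD hornerN hornerXn horner_sum.
  have -> : z ^+ d.+1 = z ^+ d * p.[z^-1] by rewrite -zp exprSr.
  rewrite horner_coef mulr_sumr -sumrB big1 // => i _.
  have -> : z ^+ d = z ^+ (d - i) * z ^+ i by rewrite -exprD subnK // ltnW.
  by rewrite hornerZ hornerXn mulrCA exprVn mulfK ?expf_neq0 // subrr.
have [|A [PA Amax]] := @Zorn_bigcup L (fun A => A = set0 \/ sub A).
  move=> F FP Ftot.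
  have [[X0 [FX0 sX0]]|Fn] := pselect (exists X, F X /\ sub X); last first.
    left; rewrite -subset0 => x [X FX Xx].
    by case: (FP X FX) => [X0|sX]; [rewrite X0 in Xx|apply: Fn; exists X].
  have sF X x : F X -> X x -> sub X.
    by move=> FX Xx; case: (FP X FX) => // X0'; rewrite X0' in Xx.
  right; split.
  - split; first by exists X0 => //; case: sX0 => -[].
      move=> x y [X FX Xx] [Y FY Yy].
      case: (Ftot X Y FX FY) => [XY|YX].
        by exists Y => //; case: (sF _ _ FY Yy) => -[_ h _] _ _ _; apply: h => //; exact: XY.
      by exists X => //; case: (sF _ _ FX Xx) => -[_ h _] _ _ _; apply: h => //; exact: YX.
    move=> x y [X FX Xx] [Y FY Yy].
    case: (Ftot X Y FX FY) => [XY|YX].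
      by exists Y => //; case: (sF _ _ FY Yy) => -[_ _ h] _ _ _; apply: h => //; exact: XY.
    by exists X => //; case: (sF _ _ FX Xx) => -[_ _ h] _ _ _; apply: h => //; exact: YX.
  - by move=> x xR; exists X0 => //; case: sX0 => _ /(_ x xR).
  - by exists X0 => //; case: sX0.
  - by move=> [X FX Xz]; case: (sF _ _ FX Xz).
have {PA} sA : sub A.
  case: PA => // A0'; exfalso; apply: (Amax A0); last by right.
  split; first by rewrite A0'.
  by move=> h; case: (subA0) => -[/h + _ _] _ _ _; rewrite A0'.
case: (sA) => -[A1 AB AM] AR Azi Az.
pose Opred : {pred L} := fun y => `[< A y >].
have Osub : subring_closed Opred.
  split; first exact/asboolP.
    by move=> x y /asboolP Ax /asboolP Ay; apply/asboolP/AB.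
  by move=> x y /asboolP Ax /asboolP Ay; apply/asboolP/AM.
pose O : subringClosed L := HB.pack Opred (GRing.isSubringClosed.Build L Opred Osub).
have OE x : (x \in O) <-> A x by split=> [/asboolP|Ax]; last exact/asboolP.
have adj x : x \notin O -> exists2 p, p \is a polyOver O & z = p.[x].
  move=> xO; pose C : set L := [set y | exists2 p, p \is a polyOver O & y = p.[x]].
  have AC : A `<=` C by move=> y /OE yO; exists y%:P; rewrite ?polyOverC ?hornerC.
  have [//|Cz] := pselect (C z); exfalso; apply: (Amax C).
    split=> // CA; have : C x by exists 'X; rewrite ?polyOverX ?hornerX.
    by move=> /CA /OE; exact/negP.
  right; split=> //.
  - split; first exact: AC.
      by move=> _ _ [p pR ->] [q qR ->]; exists (p - q); rewrite ?rpredB ?hornerD ?hornerN.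
    by move=> _ _ [p pR ->] [q qR ->]; exists (p * q); rewrite ?rpredM ?hornerM.
  - by move=> y yR; apply/AC/AR.
  - exact/AC.
exists O; split.
- move=> x; apply/negP => /negP; rewrite negb_or => /andP[xO xVO].
  have x0 : x != 0 by apply: contraNneq xO => ->; rewrite rpred0.
  have [[p pO zp] [q qO zq]] := (adj _ xO, adj _ xVO).
  have [r [rm rO rz]] := integral_of_horner_both x0 pO qO zp zq.
  by apply/Az/OE/(integral_mem_of_inv rm rO rz)/OE.
- by move=> x xR; apply/OE/AR.
- by apply/negP => /OE.
Qed.

(** * Prolongations of a discrete valuation ring *)

Section ValuationUnits.
Variables (L : fieldType) (O : subringClosed L).
Hypothesis Oval : is_valuation_ring O.

Definition val_unit : {pred L} := fun x => (x \in O) && (x \notin max_ideal O).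

Lemma val_unitE x : (x \in val_unit) = (x \in O) && (x \notin max_ideal O).
Proof. by []. Qed.

Lemma val_unitP x : reflect [/\ x != 0, x \in O & x^-1 \in O] (x \in val_unit).
Proof.
rewrite val_unitE max_idealE negb_or negbK.
by apply: (iffP and3P) => -[].
Qed.

Lemma val_unitM x y : x \in val_unit -> y \in val_unit -> x * y \in val_unit.
Proof.
move=> /val_unitP[x0 xO xVO] /val_unitP[y0 yO yVO]; apply/val_unitP.
by rewrite mulf_neq0 // invfM !rpredM.
Qed.

Lemma val_unitV x : x \in val_unit -> x^-1 \in val_unit.
Proof.
by move=> /val_unitP[x0 xO xVO]; apply/val_unitP; rewrite invr_eq0 invrK.
Qed.

Lemma val_unitX n x : x \in val_unit -> x ^+ n \in val_unit.
Proof.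
move=> /val_unitP[x0 xO xVO]; apply/val_unitP.
by rewrite expf_neq0 // -exprVn !rpredX.
Qed.

End ValuationUnits.

(** A discrete valuation ring presented by its uniformizer alone, without naming a valuation. *)
Definition dvr_uniformizer (K : fieldType) (V : {pred K}) (pi : K) : Prop :=
  [/\ pi != 0, pi \in V, pi^-1 \notin V
    & forall x, x != 0 -> exists (l : int) (u : K),
        [/\ u \in V, u^-1 \in V & x = pi ^ l * u]].

Definition residue_system (K : fieldType) (V : {pred K}) (pi : K)
    (reps : seq K) : Prop :=
  {subset reps <= V} /\
  forall x, x \in V -> exists2 r, r \in reps & (x - r) / pi \in V.

(** A valuation ring of [L] lying over [V] and centred on [pi]. The last clause bounds the degree
    over [K] of every element of [L]; it is what bounds ramification and residue degrees. *)
Definition prolongation (K : fieldType) (V : {pred K}) (pi : K) (n : nat)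
    (L : fieldType) (kappa : {rmorphism K -> L}) (O : {pred L}) : Prop :=
  [/\ is_valuation_ring O, forall c, c \in V -> kappa c \in O,
      (kappa pi)^-1 \notin O
    & forall y, exists p : {poly K},
        [/\ p != 0, (size p <= n.+1)%N & root (map_poly kappa p) y]].

(** Long division, one coefficient at a time; monicity of [psi] keeps quotient and remainder over
    [V]. *)
Lemma monic_reduction (K : fieldType) (V : subringClosed K) (psi : {poly K}) n :
  psi \is monic -> psi \is a polyOver V -> size psi = n.+1 ->
  forall p, p \is a polyOver V -> exists s r,
    [/\ s \is a polyOver V, r \is a polyOver V, (size r <= n)%N & p = s * psi + r].
Proof.
move=> pm pV sp p; elim/poly_ind: p => [_|p c IH pcV].
  by exists 0, 0; rewrite rpred0 size_poly0 mul0r addr0.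
have [|s [r [sV rV sr pE]]] := IH.
  apply/polyOverP => i; move/polyOverP: pcV => /(_ i.+1).
  by rewrite coefD coefMX coefC addr0.
have cV : c \in V.
  by move/polyOverP: pcV => /(_ 0%N); rewrite coefD coefMX coefC add0r.
pose r1 := r * 'X + c%:P.
have r1V : r1 \is a polyOver V by rewrite rpredD ?polyOverC // rpredM ?polyOverX.
exists (s * 'X + (r1`_n)%:P), (r1 - r1`_n *: psi).
have r1nV : r1`_n \in V by move/polyOverP: r1V.
split.
- by rewrite rpredD ?polyOverC // rpredM ?polyOverX.
- by rewrite rpredB // polyOverZ.
- have sr1 : (size r1 <= n.+1)%N.
    rewrite /r1 (leq_trans (size_polyD _ _)) // geq_max.
    rewrite (leq_trans (size_polyMleq _ _)) ?size_polyX ?addn2 //=.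
    by rewrite (leq_trans (size_polyC_leq1 _)).
  apply/leq_sizeP => j; rewrite leq_eqVlt coefB coefZ => /orP[/eqP<-|nj].
    by have := monicP pm; rewrite lead_coefE sp /= => ->; rewrite mulr1 subrr.
  have pj : psi`_j = 0 by rewrite nth_default // sp.
  by rewrite pj mulr0 subr0 nth_default // (leq_trans sr1).
- by rewrite pE /r1 -mul_polyC; ring.
Qed.

Section Prolongation.
Variables (K : fieldType) (V : subringClosed K) (pi : K) (n : nat).
Hypothesis Vpi : dvr_uniformizer V pi.

Lemma uniformizer_valuation_ring : is_valuation_ring V.
Proof.
move=> x; have [->|x0] := eqVneq x 0; first by rewrite rpred0.
case: Vpi => pi0 piV _ /(_ x x0)[l [u [uV uVV ->]]].
case: l => l; first by rewrite rpredM ?rpredX.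
by rewrite orbC NegzE -exprnN invfM invrK rpredM ?rpredX.
Qed.

Lemma uniformizer_dvd x : x \in max_ideal V -> x / pi \in V.
Proof.
case: Vpi => pi0 piV piVV dec.
have [->|x0] := eqVneq x 0; first by move=> _; rewrite mul0r rpred0.
rewrite max_idealE (negPf x0) /=.
have [l [u [uV uVV xE]]] := dec x x0; rewrite xE.
case: l xE => [[|l]|l] xE.
- by rewrite expr0z mul1r uVV.
- by move=> _; rewrite -exprnP exprS mulrAC (mulrAC pi) mulfV // mul1r rpredM ?rpredX.
- by rewrite NegzE -exprnN invfM invrK rpredM ?rpredX.
Qed.

Variables (L : fieldType) (kappa : {rmorphism K -> L}) (O : subringClosed L).
Hypothesis Ogood : prolongation V pi n kappa O.

Local Notation w := (kappa pi).

Lemma prol_val : is_valuation_ring O. Proof. by case: Ogood. Qed.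
Local Notation Oval := prol_val.

Lemma prol_neq0 : w != 0. Proof. by rewrite fmorph_eq0; case: Vpi. Qed.

Lemma prol_sub c : c \in V -> kappa c \in O. Proof. by case: Ogood => _ h _ _; exact: h. Qed.

Lemma prol_max : w \in max_ideal O.
Proof. by rewrite max_idealE; case: Ogood => _ _ -> _; rewrite orbT. Qed.

Lemma prol_in : w \in O. Proof. exact: (max_ideal_sub Oval prol_max). Qed.

Lemma prol_max_ideal c : c \in max_ideal V -> kappa c \in max_ideal O.
Proof.
move=> /uniformizer_dvd cV; have pi0 : pi != 0 by case: Vpi.
have -> : c = pi * (c / pi) by rewrite mulrC divfK.
by rewrite rmorphM max_idealM ?prol_sub // prol_max.
Qed.

Lemma prol_unit c : c \in V -> c^-1 \in V -> c != 0 -> kappa c \in val_unit O.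
Proof.
move=> cV cVV c0; apply/val_unitP; rewrite fmorph_eq0 c0 -fmorphV.
by rewrite !prol_sub.
Qed.

(** In the vanishing sum p(y) = 0 at least two terms share the least value. Their quotient is a
    unit, so some y^d with 0 < d <= n is a power of [w] up to a unit, and d divides n!. *)
Lemma prol_ramification y : y != 0 ->
  exists l : int, y ^+ (n`!) / w ^ l \in val_unit O.
Proof.
move=> y0; case: (Ogood) => _ _ _ /(_ y)[p [p0 sp /eqP py]].
pose t i := kappa p`_i * y ^+ i.
have tl : t (size p).-1 != 0.
  by rewrite mulf_neq0 ?expf_neq0 // fmorph_eq0 -lead_coefE lead_coef_eq0.
have sp0 : ((size p).-1 < size p)%N by rewrite prednK ?size_poly_gt0.
have [j [jp tj hj]] := dominant_term Oval sp0 tl.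
have t0 : \sum_(i < size p) t i = 0.
  apply: etrans py; rewrite horner_coef size_map_poly.
  by apply: eq_bigr => i _; rewrite coef_map.
(* If the term j alone had least value, dividing the sum by it would put 1 into the maximal
   ideal. *)
have [i [ip ij ti]] : exists i, [/\ (i < size p)%N, i != j & t i / t j \notin max_ideal O].
  apply/not_existsP => h.
  suff : 1 \in max_ideal O by rewrite max_ideal1.
  have : \sum_(i < size p) t i / t j = 0 by rewrite -mulr_suml t0 mul0r.
  rewrite (bigD1 (Ordinal jp)) //= divff // => /eqP.
  rewrite addr_eq0 => /eqP ->; rewrite max_idealN //; last exact: Oval.
  apply: max_ideal_sum => [|i ij]; first exact: Oval.
  by apply/negPn/negP => h'; apply: (h i); split.
have {hj}u : t i / t j \in val_unit O by rewrite val_unitE ti hj.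
have ti0 : t i != 0 by apply: contraNneq ti => ->; rewrite mul0r max_ideal0 //; exact: Oval.
have [pi0 pj0] : p`_i != 0 /\ p`_j != 0.
  by move: ti0 tj; rewrite /t !mulf_eq0 !negb_or !fmorph_eq0 => /andP[-> _] /andP[->].
have c0 : p`_i / p`_j != 0 by rewrite mulf_neq0 ?invr_eq0.
have [l [v [vV vVV cE]]] : exists (l : int) (u : K),
        [/\ u \in V, u^-1 \in V & p`_i / p`_j = pi ^ l * u] by case: Vpi => _ _ _; exact.
have v0 : v != 0 by apply: contraNneq c0 => v0; rewrite cE v0 mulr0.
have vu := prol_unit vV vVV v0.
have w0 := prol_neq0.
have {u}u : w ^ l * (y ^+ i / y ^+ j) \in val_unit O.
  have -> : w ^ l * (y ^+ i / y ^+ j) = t i / t j / kappa v.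
    have -> : t i / t j = kappa (p`_i / p`_j) * (y ^+ i / y ^+ j).
      by rewrite /t rmorphM fmorphV /= invfM mulrACA.
    by rewrite cE rmorphM /= fmorphXz mulrAC mulfK ?fmorph_eq0.
  by rewrite val_unitM ?val_unitV.
have [d [l' [d0 dn {}u]]] : exists (d : nat) (l : int),
    [/\ (0 < d)%N, (d <= n)%N & w ^ l * y ^+ d \in val_unit O].
  have jn : (j <= n)%N by rewrite -ltnS (leq_trans jp).
  have in_ : (i <= n)%N by rewrite -ltnS (leq_trans ip).
  case: (ltngtP i j) ij => // ij _.
  - exists (j - i)%N, (- l); split; [by rewrite subn_gt0|exact: leq_trans (leq_subr _ _) _|].
    have -> : w ^ (- l) * y ^+ (j - i) = (w ^ l * (y ^+ i / y ^+ j))^-1.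
      rewrite invfM invr_expz; congr (_ * _).
      by rewrite -{2}(subnK (ltnW ij)) exprD invf_div mulfK ?expf_neq0.
    exact: val_unitV.
  - exists (i - j)%N, l; split; [by rewrite subn_gt0|exact: leq_trans (leq_subr _ _) _|].
    by rewrite -{1}(subnK (ltnW ij)) exprD mulfK ?expf_neq0 // in u.
have /dvdnP[e ->] : (d %| n`!)%N by rewrite dvdn_fact // d0.
exists (- (l' * e%:Z)); rewrite mulnC exprM invr_expz opprK -exprz_exp.
by rewrite mulrC -exprnP -exprMn val_unitX.
Qed.

Variable reps : seq K.
Hypothesis hreps : residue_system V pi reps.

(** The residue of [y] has degree at most n over the residue field of [V], which has at most q =
    [size reps] elements. So the powers of [y] have at most q^n residues, two of them coincide, and
    some y^e with 0 < e <= q^n is a 1-unit; e divides (q^n)!. *)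
Lemma prol_residue y : y \in val_unit O ->
  y ^+ ((size reps ^ n)`!) \in one_unit O.
Proof.
move=> /val_unitP[y0 yO yVO]; case: (Ogood) => _ _ _ /(_ y)[p [p0 sp /eqP py]].
have Vval := uniformizer_valuation_ring.
have sp0 : ((size p).-1 < size p)%N by rewrite prednK ?size_poly_gt0.
have [||j [jp pj hj]] := @dominant_term _ _ Vval (size p) (fun i => p`_i) (size p).-1.
- by [].
- by rewrite -lead_coefE lead_coef_eq0.
pose c i := p`_i / p`_j.
have cV i : c i \in V.
  have [ip|pi_] := ltnP i (size p); first exact: hj.
  by rewrite /c nth_default // mul0r rpred0.
(* Let d be the last index at which the scaled polynomial has a unit coefficient: the terms above d
   vanish in the residue field, which leaves a monic equation [psi] of degree d for the residue of
   [y]. *)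
have ex : exists i, (i < size p)%N && (c i \notin max_ideal V).
  by exists j; rewrite jp /c divff // max_ideal1.
have bd i : (i < size p)%N && (c i \notin max_ideal V) -> (i <= size p)%N.
  by move=> /andP[/ltnW].
case: (ex_maxnP ex bd) => d /andP[dp cd] dmax.
have cd0 : c d != 0 by apply: contraNneq cd => ->; rewrite max_ideal0.
have cdV : (c d)^-1 \in V by apply: max_ideal_unit.
pose psi : {poly K} := \poly_(i < d.+1) (c i / c d).
have psiV : psi \is a polyOver V.
  by apply/polyOver_poly => i _; rewrite rpredM.
have spsi : size psi = d.+1 by rewrite size_poly_eq // divff // oner_eq0.
have mpsi : psi \is monic by rewrite monicE lead_coefE spsi coef_poly ltnSn divff.
have psiy : (map_poly kappa psi).[y] \in max_ideal O.
  have : \sum_(i < size p) kappa (c i / c d) * y ^+ i = 0.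
    transitivity ((map_poly kappa p).[y] * kappa (p`_j * c d)^-1); last by rewrite py mul0r.
    rewrite horner_coef size_map_poly mulr_suml; apply: eq_bigr => i _.
    rewrite coef_map /= [RHS]mulrAC -rmorphM; congr (kappa _ * _).
    by rewrite [in RHS]invfM mulrA.
  rewrite -(big_mkord xpredT (fun i => kappa (c i / c d) * y ^+ i)).
  rewrite (big_cat_nat (n := d.+1)) //= => /eqP; rewrite addr_eq0 => /eqP h.
  rewrite horner_coef size_map_poly spsi.
  have -> : \sum_(i < d.+1) (map_poly kappa psi)`_i * y ^+ i =
      \sum_(0 <= i < d.+1) kappa (c i / c d) * y ^+ i.
    by rewrite big_mkord; apply: eq_bigr => i _; rewrite coef_map coef_poly ltn_ord.
  rewrite h max_idealN; last exact: Oval.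
  rewrite big_nat_cond; apply: max_ideal_sum => [|i]; first exact: Oval.
  rewrite andbT => /andP[di ip]; apply: max_idealM; last by rewrite rpredX.
  apply/prol_max_ideal/max_idealM => //; apply/negPn/negP => ci.
  by have := dmax i; rewrite ip ci /= => /(_ isT); rewrite leqNgt di.
have dn : (d <= n)%N by rewrite -ltnS (leq_trans dp).
have horO (q : {poly K}) : q \is a polyOver V -> (map_poly kappa q).[y] \in O.
  move=> /polyOverP qV; rewrite rpred_horner //.
  by apply/polyOverP => i; rewrite coef_map; apply: prol_sub.
pose q := size reps.
(* Reducing X^k modulo [psi] and replacing the remainder's coefficients by representatives encodes
   the residue of y^k in a finite type. *)
have red k : exists f : {ffun 'I_n -> 'I_q},
    y ^+ k - \sum_(i < n) kappa reps`_(f i) * y ^+ i \in max_ideal O.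
  have [s [r [sV rV sr XE]]] :=
    monic_reduction mpsi psiV spsi (rpredX k (polyOverX V)).
  have /fin_all_exists[f hf] (i : 'I_n) :
      exists a : 'I_q, (r`_i - reps`_a) / pi \in V.
    have rV' : r`_i \in V by move/polyOverP: rV.
    have [b br hb] := hreps.2 _ rV'.
    have bq : (index b reps < q)%N by rewrite index_mem.
    by exists (Ordinal bq); rewrite /= nth_index.
  exists [ffun i => f i].
  have -> : y ^+ k = (map_poly kappa s).[y] * (map_poly kappa psi).[y] + (map_poly kappa r).[y].
    by rewrite -hornerM -hornerD -rmorphM -rmorphD /= -XE map_polyXn hornerXn.
  rewrite -addrA; apply: max_idealD => //; first exact: Oval.
    by rewrite mulrC; apply: max_idealM => //; apply: horO.
  rewrite (horner_coef_wide (n := n)); last by rewrite size_map_poly (leq_trans sr).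
  rewrite -sumrB; apply: max_ideal_sum => [|i _]; first exact: Oval.
  rewrite ffunE coef_map -mulrBl -rmorphB; apply: max_idealM; last by rewrite rpredX.
  have pi0 : pi != 0 by case: Vpi.
  rewrite -[X in kappa X](divfK pi0) rmorphM mulrC max_idealM ?prol_max //.
  exact: prol_sub.
have /fin_all_exists[F hF] (k : 'I_(q ^ n).+1) := red k.
(* Pigeonhole: q^n + 1 exponents against q^n codes. *)
have : ~~ injectiveb F.
  apply/injectiveP => /leq_card; rewrite card_ffun !card_ord.
  by rewrite ltnn.
move=> /injectivePn[k1 [k2 k12 Fk]].
have {red hF Fk} kk : y ^+ k1 - y ^+ k2 \in max_ideal O.
  have := hF k2; rewrite -(max_idealN Oval) => /(max_idealD Oval (hF k1)).
  by rewrite Fk opprB addrA subrK.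
have [e [e0 eq he]] : exists e, [/\ (0 < e)%N, (e <= q ^ n)%N & y ^+ e \in one_unit O].
  wlog k1k2 : k1 k2 k12 kk / (k1 < k2)%N => [H|].
    case: (ltngtP k1 k2) => h.
    - exact: (H k1 k2).
    - apply: (H k2 k1) => //; first by rewrite eq_sym.
      by rewrite -max_idealN ?opprB //; exact: Oval.
    - by move: k12; rewrite -(inj_eq val_inj) /= h eqxx.
  exists (k2 - k1)%N; split; first by rewrite subn_gt0.
    by rewrite (leq_trans (leq_subr _ _)) // -ltnS.
  rewrite /one_unit unfold_in.
  have -> : y ^+ (k2 - k1) - 1 = - (y ^+ k1 - y ^+ k2) * y^-1 ^+ k1.
    have -> : y ^+ k2 = y ^+ (k2 - k1) * y ^+ k1 by rewrite -exprD subnK // ltnW.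
    by rewrite exprVn opprB mulrBl mulfK ?divff ?expf_neq0.
  by apply: max_idealM; rewrite ?max_idealN ?rpredX //; exact: Oval.
have /dvdnP[a ->] : (e %| (q ^ n)`!)%N by rewrite dvdn_fact // e0.
by rewrite mulnC exprM; apply: one_unitX => //; exact: Oval.
Qed.

(** The first factor absorbs ramification, the second turns units into 1-units; the product depends
    only on [n] and [reps], so it serves all prolongations at once. *)
Definition residue_exponent : nat := n`! * (size reps ^ n)`!.

Lemma residue_exponent_gt0 : (0 < residue_exponent)%N.
Proof. by rewrite muln_gt0 !fact_gt0. Qed.

Lemma prol_expansion y : y != 0 ->
  exists l : int, y ^+ residue_exponent / w ^ l \in one_unit O.
Proof.
move=> /prol_ramification[l /prol_residue]; rewrite exprMn -exprM => h.
by exists (l * (size reps ^ n)`!%:Z); rewrite -exprz_exp -exprnP -exprVn.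
Qed.

End Prolongation.

(** * Local partitions of unity *)

Section LocalPartition.
Variables (K : fieldType) (V : subringClosed K) (pi : K) (n : nat) (reps : seq K).
Hypotheses (Vpi : dvr_uniformizer V pi) (hreps : residue_system V pi reps).

Local Notation T := (residue_exponent n reps).
Local Notation prol := (@prolongation K V pi n _).
Local Notation ev kappa f x := (map_poly kappa f).[x].

Section OneProlongation.
Variables (L : fieldType) (kappa : {rmorphism K -> L}) (O : subringClosed L).
Hypothesis hO : prol kappa O.
Local Notation w := (kappa pi).
Let Oval := prol_val hO.
Let w0 : w != 0 := prol_neq0 Vpi kappa.
Let wO : w \in O := prol_in hO.

Lemma prol_unit_exponent y : y \in val_unit O -> y ^+ T \in one_unit O.
Proof.
by move=> yu; rewrite /residue_exponent mulnC exprM; apply/one_unitX/(prol_residue Vpi hO hreps yu).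
Qed.

(** x^T is w^l times a 1-unit and still lies in the maximal ideal, which forces l >= 1. *)
Lemma prol_max_exponent x : x \in max_ideal O -> x ^+ T / w \in O.
Proof.
move=> xm; have [->|x0] := eqVneq x 0.
  by rewrite expr0n (gtn_eqF (residue_exponent_gt0 _ _)) mul0r rpred0.
have [l lu] := prol_expansion Vpi hO hreps x0.
have xTm : x ^+ T \in max_ideal O.
  by rewrite -(prednK (residue_exponent_gt0 n reps)); apply: max_idealX.
case: l lu => [[|l]|l] lu.
- by have := one_unit_notin Oval lu; rewrite expr0z divr1 xTm.
- have -> : x ^+ T = (x ^+ T / w ^ l.+1) * w ^ l.+1 by rewrite divfK // expfz_neq0.
  move: (x ^+ T / _) lu => u lu; rewrite -exprnP exprSr mulrA mulfK //.
  by apply: rpredM; [exact: one_unit_sub lu|rewrite rpredX].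
- have := max_idealM xTm (rpredX l.+1 wO).
  have -> : x ^+ T * w ^+ l.+1 = x ^+ T / w ^ (Negz l) by rewrite NegzE -exprnN invrK.
  by rewrite (negPf (one_unit_notin Oval lu)).
Qed.

Lemma prol_exponent_ge0 m (l : int) :
  m \in O -> m ^+ T / w ^ l \in one_unit O -> 0 <= l.
Proof.
move=> mO; case: l => // l; rewrite NegzE -exprnN invrK => h.
have := max_idealM (max_idealX Oval l (prol_max hO)) (rpredX T mO).
by rewrite mulrC (negPf (one_unit_notin Oval h)).
Qed.

(** If l exceeded kT, then w^-(l - kT) = (w^k / m)^T (m^T / w^l) would lie in [O], and with it
    w^-1. *)
Lemma prol_exponent_le k m (l : nat) : m != 0 -> w ^+ k / m \in O ->
  m ^+ T / w ^+ l \in one_unit O -> (l <= k * T)%N.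
Proof.
move=> m0 kO h; rewrite leqNgt; apply/negP => kl.
case: (hO) => _ _ /negP wV _; apply: wV.
apply: (@val_ring_root _ _ Oval (l - k * T).-1).
rewrite prednK ?subn_gt0 //.
have -> : w^-1 ^+ (l - k * T) = (w ^+ k / m) ^+ T * (m ^+ T / w ^+ l).
  have -> : w ^+ l = w ^+ (l - k * T) * w ^+ (k * T) by rewrite -exprD subnK // ltnW.
  rewrite expr_div_n -exprM mulrA divfK ?expf_neq0 // invfM mulrCA mulfV ?expf_neq0 //.
  by rewrite mulr1 exprVn.
by rewrite rpredM ?rpredX // ?(one_unit_sub Oval).
Qed.

Lemma prol_ev f x : f \is a polyOver V -> x \in O -> ev kappa f x \in O.
Proof.
move=> /polyOverP fV xO; rewrite rpred_horner //.
by apply/polyOverP => i; rewrite coef_map; apply: (prol_sub hO).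
Qed.

End OneProlongation.

(* On classes that are 0 or 1, the form a^2 - a b + b^2 computes the maximum;
   iterating it on T-th powers yields a form in the g i, with coefficients h i,
   that is equivalent to a power of any g i of least value. *)
Lemma dominant_form (g : nat -> {poly K}) r :
  exists (c : nat) (h : nat -> {poly K}), (0 < c)%N /\
  forall (L : fieldType) (kappa : {rmorphism K -> L}) (O : subringClosed L) x m,
    prol kappa O -> m != 0 ->
    (forall i, (i <= r)%N -> ev kappa (g i) x / m \in O) ->
    (forall i, (i <= r)%N -> ev kappa (h i) x / m ^+ (T * c).-1 \in O) /\
    ((exists2 i, (i <= r)%N & ev kappa (g i) x / m \notin max_ideal O) ->
     ev kappa (\sum_(i < r.+1) g i * h i) x / m ^+ (T * c) \in one_unit O).
Proof.
have T0 := residue_exponent_gt0 n reps.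
elim: r => [|r [c [h [c0 IH]]]].
  exists 1%N, (fun _ => g 0%N ^+ T.-1); split=> // L kappa O x m hO m0 gO.
  rewrite muln1; split=> [i _|[i]].
    by rewrite rmorphXn horner_exp -expr_div_n rpredX // gO.
  rewrite leqn0 => /eqP-> gu; rewrite big_ord1 -exprS prednK // rmorphXn horner_exp -expr_div_n.
  by apply: (prol_unit_exponent hO); rewrite val_unitE gO.
pose d := (T * c)%N; have d0 : (0 < d)%N by rewrite muln_gt0 T0.
pose a := \sum_(i < r.+1) g i * h i.
(* With d = T c and g the last of the [g i], the new form is a^2 - a g^d + g^(2d), of degree 2d. The
   factor [g i] is split off from a^2 through a = sum g i * h i, and g from the other two terms. *)
exists c.*2, (fun i => if (i <= r)%N then a * h i
  else g i ^+ (d + d.-1) - a * g i ^+ d.-1); split; first by rewrite double_gt0.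
move=> L kappa O x m hO m0 gO.
have -> : (T * c.*2 = d + d)%N by rewrite -doubleMr -addnn.
have [|hhO aun] := IH L kappa O x m hO m0; first by move=> i ir; apply: gO; rewrite leqW.
have Oval := prol_val hO.
have -> : (d + d).-1 = (d + d.-1)%N by rewrite -{2}(prednK d0) addnS.
set A := ev kappa a x / m ^+ d; set B := ev kappa (g r.+1) x / m.
have BO : B \in O by apply: gO.
have AE : A = \sum_(i < r.+1) ev kappa (g i) x / m * (ev kappa (h i) x / m ^+ d.-1).
  rewrite /A /a rmorph_sum horner_sum mulr_suml; apply: eq_bigr => i _.
  rewrite rmorphM hornerM -{1}(prednK d0) exprS invfM; exact: mulrACA.
have AO : A \in O.
  rewrite AE rpred_sum // => i _; have ir : (i <= r)%N by rewrite -ltnS.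
  by rewrite rpredM ?hhO ?gO // leqW.
split=> [i|[i0 i0r gu]].
  rewrite leq_eqVlt => /orP[/eqP->|]; last rewrite ltnS => ir.
    rewrite ltnn rmorphB hornerD hornerN rmorphM hornerM !rmorphXn !horner_exp.
    rewrite mulrBl -expr_div_n (exprD m) invfM mulrACA -expr_div_n -/A -/B.
    by apply: rpredB; [exact: rpredX|apply: rpredM => //; exact: rpredX].
  by rewrite ir rmorphM hornerM exprD invfM mulrACA rpredM ?hhO.
have -> : ev kappa (\sum_(i < r.+2) g i * (if (i <= r)%N then a * h i
    else g i ^+ (d + d.-1) - a * g i ^+ d.-1)) x / m ^+ (d + d)
    = A ^+ 2 - A * B ^+ d + (B ^+ d) ^+ 2.
  rewrite big_ord_recr /= ltnn.
  under eq_bigr => i _ do rewrite -ltnS ltn_ord mulrCA.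
  rewrite -mulr_sumr -/a mulrBr mulrCA -!exprS -addnS prednK //.
  rewrite !rmorphD rmorphN !rmorphM !rmorphXn /= !(hornerD, hornerN, hornerM, horner_exp).
  rewrite /A /B !expr2 !exprD expr_div_n.
  have : m ^+ d != 0 by rewrite expf_neq0.
  move: (m ^+ d) (ev kappa (g r.+1) x) => M G M0.
  by move: (G ^+ d) => H; field.
have Bu : B \notin max_ideal O -> B ^+ d \in one_unit O.
  move=> Bm; rewrite exprM; apply: (one_unitX Oval).
  by apply: (prol_unit_exponent hO); rewrite val_unitE BO.
have Bm : B \in max_ideal O -> B ^+ d \in max_ideal O.
  by move=> ?; rewrite -(prednK d0); apply: max_idealX.
have BdO : B ^+ d \in O by rewrite rpredX.
move: (B ^+ d) Bu Bm BdO => C Cu Cm CO.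
apply/one_unitP; rewrite /one_unit.
(* Modulo the maximal ideal, [A] and [C] (that is, B^d) are 0 or 1 and not both 0; in each of the
   three cases A^2 - A C + C^2 is 1. *)
have [[i ir giu]|none] := pselect (exists2 i, (i <= r)%N & ev kappa (g i) x / m \notin max_ideal O).
  have /one_unitP[u um ->] : A \in one_unit O by apply: aun; exists i.
  have uO := max_ideal_sub Oval um.
  have [Bm'|Bn] := boolP (B \in max_ideal O).
    have {}Cm := Cm Bm'; exists (u * (2 + u) + C * (C - 1 - u)); last by ring.
    by rewrite max_idealD ?max_idealM ?rpredD ?rpredB ?rpredN ?rpred1 ?rpred_nat.
  have /one_unitP[v vm ->] := Cu Bn; have vO := max_ideal_sub Oval vm.
  exists (u * (1 + u - v) + v * (1 + v)); last by ring.
  by rewrite max_idealD ?max_idealM ?rpredD ?rpredB ?rpredN ?rpred1.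
have Am : A \in max_ideal O.
  rewrite AE; apply: max_ideal_sum => // i _; have ir : (i <= r)%N by rewrite -ltnS.
  apply: max_idealM => //; last exact: hhO.
  by apply/negPn/negP => gn; apply: none; exists i.
have Bn : B \notin max_ideal O.
  move: i0r gu; rewrite leq_eqVlt => /orP[/eqP->//|i0r gu].
  by case: none; exists i0.
have /one_unitP[v vm ->] := Cu Bn; have vO := max_ideal_sub Oval vm.
clear AE aun; clearbody A.
exists (A * (A - 1 - v) + v * (2 + v)); last by ring.
by rewrite max_idealD ?max_idealM ?rpredD ?rpredB ?rpredN ?rpred1 ?rpred_nat.
Qed.

(* E is a product of powers of the 1 - y / pi^j, j < N; the exponents decrease
   fast enough for the small factor j = l to absorb the poles of the later ones. *)
Lemma small_polynomial (k N : nat) : exists E : {poly K}, E.[0] = 1 /\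
  forall (L : fieldType) (kappa : {rmorphism K -> L}) (O : subringClosed L) y (l : nat),
    prol kappa O -> y / kappa pi ^+ l \in one_unit O ->
    ((l < N)%N -> ev kappa E y / kappa pi ^+ k \in O) /\
    ((N <= l)%N -> ev kappa E y \in O).
Proof.
elim: N => [|N [E [E0 IH]]].
  exists 1; split=> [|L kappa O y l hO yl]; first by rewrite hornerC.
  by split=> // _; rewrite rmorph1 hornerC rpred1.
pose e : {poly K} := 1 - (pi ^- N) *: 'X.
(* For l < N the pole of e^(Tk) is at most w^(NTk), while E^(NT+1) supplies w^(NTk+k), leaving w^k.
   For l = N the value of [e] is in the maximal ideal, so its T-th power is divisible by [w]. *)
exists (E ^+ (N * T).+1 * e ^+ (T * k)); split.
  by rewrite hornerM !horner_exp E0 /e !hornerE ?mulr0 ?subr0 !expr1n ?mul1r.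
move=> L kappa O y l hO yl; have [IHlt IHge] := IH L kappa O y l hO yl.
have Oval := prol_val hO; have w0 := prol_neq0 Vpi kappa; have wO := prol_in hO.
set w := kappa pi in yl IHlt IHge w0 wO *.
have yO : y \in O.
  by rewrite -(divfK (expf_neq0 l w0) y) rpredM ?rpredX // ?(one_unit_sub Oval).
have evE : ev kappa e y = 1 - y / w ^+ N.
  rewrite /e rmorphB rmorph1 /= map_polyZ map_polyX !hornerE fmorphV rmorphXn.
  by rewrite mulrC.
rewrite rmorphM !rmorphXn hornerM !horner_exp /= evE.
case: (ltngtP l N) => [lN|Nl|lN]; split=> // h; try by exfalso; lia.
- have EO := IHlt lN.
  have -> : ev kappa E y ^+ (N * T).+1 * (1 - y / w ^+ N) ^+ (T * k) / w ^+ k =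
      (ev kappa E y / w ^+ k) ^+ (N * T).+1 * (w ^+ N - y) ^+ (T * k).
    have -> : w ^+ N - y = (1 - y / w ^+ N) * w ^+ N by rewrite mulrBl mul1r divfK ?expf_neq0.
    rewrite expr_div_n exprMn -!exprM.
    have -> : (k * (N * T).+1 = N * (T * k) + k)%N by rewrite mulnS mulnC mulnA addnC.
    rewrite exprD; have := expf_neq0 k w0; have := expf_neq0 (N * (T * k)) w0.
    move: (w ^+ k) (w ^+ (N * (T * k))) => u v v0 u0.
    by field; rewrite u0 v0.
  by rewrite rpredM ?rpredX ?rpredB ?rpredX.
- have eO : 1 - y / w ^+ N \in O.
    have -> : y / w ^+ N = y / w ^+ l * w ^+ (l - N).
      rewrite -{1}(subnK (ltnW Nl)) exprD invfM mulrA mulrAC divfK ?expf_neq0 //.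
    by rewrite rpredB ?rpred1 // rpredM ?rpredX // ?(one_unit_sub Oval).
  by rewrite rpredM ?rpredX // IHge // ltnW.
- have em : 1 - y / w ^+ N \in max_ideal O by rewrite -lN -max_idealN // opprB.
  rewrite -mulrA exprM -expr_div_n rpredM ?rpredX ?IHge ?lN //.
  exact: (prol_max_exponent hO).
Qed.

(** With f the dominant form and 1 - E = W X, put Y_i = h_i W(f) + pi^-k E(f) a_i; then sum Y_i g_i
    = W(f) f + E(f) = 1. Integrality holds for each summand of Y_i g_j: with m the value g_i(x)
    dividing all the others, f(x) is m^(Tc) up to a unit, which balances h_i g_j / f, and E(f) is
    divisible by pi^k. *)
Lemma local_partition (g a : nat -> {poly K}) r k :
  (forall i, g i \is a polyOver V) -> (forall i, a i \is a polyOver V) ->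
  \sum_(i < r.+1) a i * g i = (pi ^+ k)%:P ->
  exists Y : nat -> {poly K}, \sum_(i < r.+1) Y i * g i = 1 /\
  forall (L : fieldType) (kappa : {rmorphism K -> L}) (O : subringClosed L) x,
    prol kappa O -> x \in O -> forall i j, (i <= r)%N -> (j <= r)%N ->
    ev kappa (Y i * g j) x \in O.
Proof.
move=> gV aV ag; have pi0 : pi != 0 by case: Vpi.
have [c [h [c0 hform]]] := dominant_form g r.
(* f(x) will be w^(lc) times a 1-unit with l <= kT, so kTc + 1 strictly exceeds every exponent that
   occurs. *)
have [E [E0 hE]] := small_polynomial k (k * T * c).+1.
have [W WE] : exists W, 1 - E = W * 'X.
  have /factor_theorem[W WE] : root (1 - E) 0 by rewrite /root !hornerE E0 subrr.
  by exists W; rewrite WE subr0.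
pose f := \sum_(i < r.+1) g i * h i.
exists (fun i => h i * (W \Po f) + pi ^- k *: (E \Po f) * a i); split.
  have -> W' E' : \sum_(i < r.+1) (h i * W' + E' * a i) * g i =
      W' * f + E' * \sum_(i < r.+1) a i * g i.
    by rewrite /f !mulr_sumr -big_split; apply: eq_bigr => i _ /=; ring.
  rewrite ag.
  have <- : 1 - (E \Po f) = (W \Po f) * f.
    by rewrite -{3}[f]comp_polyX -rmorphM -WE rmorphB rmorph1.
  by rewrite -scalerAl mulrC mul_polyC scalerA mulVf ?expf_neq0 // scale1r subrK.
move=> L kappa O x hO xO i j ir jr.
have Oval := prol_val hO; have w0 := prol_neq0 Vpi kappa; have wO := prol_in hO.
pose t i := ev kappa (g i) x.
have agw : \sum_(i < r.+1) ev kappa (a i) x * t i = kappa pi ^+ k.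
  transitivity (ev kappa (\sum_(i < r.+1) a i * g i) x).
    by rewrite rmorph_sum horner_sum; apply: eq_bigr => l _; rewrite rmorphM hornerM.
  by rewrite ag map_polyC hornerC /= rmorphXn.
have [i0 i0r ti0] : exists2 i0, (i0 < r.+1)%N & t i0 != 0.
  have [//|none] := pselect (exists2 i0, (i0 < r.+1)%N & t i0 != 0).
  have /eqP : kappa pi ^+ k != 0 by rewrite expf_neq0.
  case; rewrite -agw big1 // => l _; case: (eqVneq (t l) 0) => [->|tl]; rewrite ?mulr0 //.
  by case: none; exists l.
have [j0 [j0r tj0 dom]] := dominant_term Oval i0r ti0.
set m := t j0 in tj0 dom.
have mO : m \in O by apply: (prol_ev hO).
have [hO' fu] := hform L kappa O x m hO tj0 dom.
have {}fu : ev kappa f x / m ^+ (T * c) \in one_unit O.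
  by apply: fu; exists j0 => //; rewrite -/(t j0) divff // max_ideal1.
have [l0 lu] := prol_expansion Vpi hO hreps tj0.
have := prol_exponent_ge0 hO mO lu; case: l0 lu => // l lu _; rewrite -exprnP in lu.
(* [m] divides every g_i(x), hence also w^k = sum a_i(x) g_i(x). *)
have lk : (l <= k * T)%N.
  apply: (prol_exponent_le hO tj0) lu.
  rewrite -agw mulr_suml rpred_sum // => i1 _; rewrite -mulrA rpredM ?dom //.
  exact: (prol_ev hO).
have yl : ev kappa f x / kappa pi ^+ (l * c) \in one_unit O.
  have -> : ev kappa f x / kappa pi ^+ (l * c) =
      ev kappa f x / m ^+ (T * c) * (m ^+ T / kappa pi ^+ l) ^+ c.
    by rewrite expr_div_n -!exprM mulrA divfK ?expf_neq0.
  by apply: one_unitM => //; apply: one_unitX.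
have [/(_ _)EO _] := hE L kappa O _ _ hO yl.
have {}EO : ev kappa E (ev kappa f x) / kappa pi ^+ k \in O.
  by apply: EO; rewrite ltnS leq_mul2r lk orbT.
set y := ev kappa f x in fu yl EO.
have EO' : ev kappa E y \in O by rewrite -(divfK (expf_neq0 k w0) (ev kappa E y)) rpredM ?rpredX.
have y0 : y != 0.
  by have := one_unit_neq0 Oval yl; apply: contraNneq => ->; rewrite mul0r.
have WyE : ev kappa W y = (1 - ev kappa E y) / y.
  apply: (mulIf y0); rewrite divfK //.
  have := congr1 (fun p => ev kappa p y) WE.
  by rewrite /= rmorphB rmorph1 rmorphM /= map_polyX !hornerE => <-.
have comp_ev p : ev kappa (p \Po f) x = ev kappa p y by rewrite map_comp_poly horner_comp.
rewrite mulrDl rmorphD hornerD rpredD //; last first.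
  rewrite !rmorphM /= map_polyZ !hornerM hornerZ comp_ev fmorphV rmorphXn.
  rewrite [_^-1 * _]mulrC; apply: rpredM; last exact: (prol_ev hO).
  by apply: rpredM => //; exact: (prol_ev hO).
rewrite !rmorphM !hornerM comp_ev WyE -/(t j).
have -> : ev kappa (h i) x * ((1 - ev kappa E y) / y) * t j =
    ev kappa (h i) x / m ^+ (T * c).-1 * (t j / m) * (y / m ^+ (T * c))^-1 * (1 - ev kappa E y).
  have Tc0 : (0 < T * c)%N by rewrite muln_gt0 residue_exponent_gt0.
  rewrite -{2}(prednK Tc0) exprSr; have := expf_neq0 (T * c).-1 tj0.
  move: (m ^+ _) => M M0; by field; rewrite M0 tj0 y0.
apply: rpredM; last by rewrite rpredB ?rpred1.
apply: rpredM; last exact/(one_unit_sub Oval)/(one_unitV Oval).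
by apply: rpredM; [exact: hO'|exact: dom].
Qed.

End LocalPartition.

(** * Integrality through valuation rings *)

(** Divide by a coefficient of least value. The first index with a unit coefficient is recorded for
    the Gauss argument that follows. *)
Lemma primitive_scaling (K : fieldType) (V : subringClosed K) (p : {poly K}) :
  is_valuation_ring V -> p != 0 ->
  exists c q, [/\ c != 0, p = c *: q, q \is a polyOver V
    & exists i, q`_i \notin max_ideal V /\ forall j, (j < i)%N -> q`_j \in max_ideal V].
Proof.
move=> Vval p0.
have sp0 : ((size p).-1 < size p)%N by rewrite prednK ?size_poly_gt0.
have [||j [jp pj hj]] := @dominant_term _ _ Vval (size p) (fun i => p`_i) (size p).-1.
- by [].
- by rewrite -lead_coefE lead_coef_eq0.
have qV i : ((p`_j)^-1 *: p)`_i \in V.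
  rewrite coefZ mulrC; have [ip|pi] := ltnP i (size p); first exact: hj.
  by rewrite nth_default // mul0r rpred0.
exists p`_j, ((p`_j)^-1 *: p); split=> //.
- by rewrite scalerA divff // scale1r.
- exact/polyOverP.
have ex : exists i, ((p`_j)^-1 *: p)`_i \notin max_ideal V.
  by exists j; rewrite coefZ mulVf // max_ideal1.
case: (ex_minnP ex) => i qi imin; exists i; split=> // k ki.
by apply/negPn/negP => /imin; rewrite leqNgt ki.
Qed.

(** Gauss's lemma. Write p = c p' and q = d q' with p', q' primitive: the coefficient of p' q' at
    the sum of the first unit indices is a unit, so cd is in [V]; d^-1 is the leading coefficient of
    q', so c = (cd) d^-1 is in [V] too. *)
Lemma monic_factor_polyOver (K : fieldType) (V : subringClosed K) (p q : {poly K}) :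
  is_valuation_ring V -> p \is monic -> q \is monic ->
  p * q \is a polyOver V -> p \is a polyOver V.
Proof.
move=> Vval pm qm /polyOverP pqV.
have [c [p' [c0 pE p'V [i [p'i p'j]]]]] := primitive_scaling Vval (monic_neq0 pm).
have [d [q' [d0 qE q'V [j [q'j q'k]]]]] := primitive_scaling Vval (monic_neq0 qm).
have p'VP := polyOverP p'V; have q'VP := polyOverP q'V.
have dV : d^-1 \in V.
  have := monicP qm; rewrite qE lead_coefZ => /(canRL (mulKf d0)); rewrite mulr1 => <-.
  exact: q'VP.
have u : (p' * q')`_(i + j) \in val_unit V.
  rewrite coefM; have ij : (i < (i + j).+1)%N by rewrite ltnS leq_addr.
  rewrite (bigD1 (Ordinal ij)) //= addKn val_unitE; apply/andP; split.
    by rewrite rpredD ?rpredM ?rpred_sum // => k _; rewrite rpredM.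
  set s := \sum_(_ < _ | _) _.
  have sm : s \in max_ideal V.
    apply: max_ideal_sum => // k; rewrite -(inj_eq val_inj) /= => ki.
    case: (ltngtP k i) ki => // ki _; first by rewrite max_idealM ?p'j.
    by rewrite mulrC max_idealM // q'k //; have := ltn_ord k; lia.
  apply/negP => h; have := max_idealD Vval h (_ : - s \in max_ideal V).
  rewrite max_idealN // addrK => /(_ sm) h'.
  have /val_unitP[_ _ uV] : p'`_i * q'`_j \in val_unit V.
    by rewrite val_unitM // val_unitE ?p'VP ?q'VP ?p'i ?q'j.
  by move: h'; rewrite max_idealE uV orbF mulf_eq0 => /orP[] /eqP h0;
    [move: p'i|move: q'j]; rewrite h0 max_ideal0.
have cdV : c * d \in V.
  have /val_unitP[u0 uV uVV] := u.
  rewrite -[c * d](mulfK u0) rpredM //.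
  by have := pqV (i + j)%N; rewrite pE qE -scalerAl -scalerAr scalerA coefZ.
rewrite pE polyOverZ // -[c](mulfK d0); exact: rpredM.
Qed.

(** The monic gcd of [p] and [q] works: it is no longer than [p], and as a monic factor of [q] it
    has coefficients in [V]. *)
Lemma integral_small_degree (K L : fieldType) (V : subringClosed K)
    (kappa : {rmorphism K -> L}) (p q : {poly K}) (z : L) :
  is_valuation_ring V -> p != 0 -> root (map_poly kappa p) z ->
  q \is monic -> q \is a polyOver V -> root (map_poly kappa q) z ->
  exists m, [/\ m \is monic, m \is a polyOver V, (size m <= size p)%N
              & root (map_poly kappa m) z].
Proof.
move=> Vval p0 pz qm qV qz; pose d := gcdp p q.
have d0 : d != 0 by rewrite gcdp_eq0 negb_and p0.
have ld0 : lead_coef d != 0 by rewrite lead_coef_eq0.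
pose m := (lead_coef d)^-1 *: d.
have mm : m \is monic by rewrite monicE lead_coefZ mulVf.
have md : m %= d by rewrite eqp_scale // invr_eq0.
have /dvdpP[e qE] : m %| q by rewrite (eqp_dvdl _ md) dvdp_gcdr.
have em : e \is monic.
  by have := monicP qm; rewrite qE lead_coefM (monicP mm) mulr1 => /eqP; rewrite monicE.
exists m; split=> //.
- by apply: (@monic_factor_polyOver K V m e) => //; rewrite mulrC -qE.
- by rewrite (eqp_size md) dvdp_leq // dvdp_gcdl.
- rewrite map_polyZ rootZ ?fmorph_eq0 ?invr_eq0 //.
  by rewrite gcdp_map root_gcd pz.
Qed.

Lemma irreducible_dvd_root (K L : fieldType) (kappa : {rmorphism K -> L})
    (p q : {poly K}) (x : L) : irreducible_poly p ->
  root (map_poly kappa p) x -> root (map_poly kappa q) x -> p %| q.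
Proof.
move=> pirr px qx; apply/negPn/negP; rewrite -irreducible_poly_coprime // => cpq.
by move: cpq; rewrite -(coprimep_map kappa) => /coprimep_root /(_ px); rewrite -rootE qx.
Qed.

Lemma fieldext_annihilator (K : fieldType) (L : fieldExtType K) (y : L) :
  exists p : {poly K}, [/\ p != 0, (size p <= (\dim {:L}).+1)%N
    & root (map_poly (in_alg L) p) y].
Proof.
pose d := \dim {:L}; pose X := [tuple y ^+ i | i < d.+1].
have nfree : ~~ free X.
  apply/negP => /eqP; rewrite size_tuple => h.
  by have := dimvS (subvf <<X>>%VS); rewrite h ltnn.
have [c [c0 [i ci]]] : exists c : 'I_d.+1 -> K,
    \sum_(i < d.+1) c i *: X`_i = 0 /\ exists i, c i != 0.
  apply/not_existsP => h; move/freeP: nfree; apply => c c0 i.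
  by apply/eqP/negPn/negP => ci; apply: (h c); split=> //; exists i.
have XE (j : 'I_d.+1) : X`_j = y ^+ j by rewrite -tnth_nth tnth_mktuple.
exists (\poly_(i < d.+1) c (inord i)); split; last 2 first.
- exact: size_poly.
- rewrite /root (horner_coef_wide (n := d.+1)); last by rewrite size_map_poly size_poly.
  rewrite -[X in _ == X]c0; apply/eqP/eq_bigr => j _.
  by rewrite XE coef_map coef_poly ltn_ord inord_val /= mulr_algl.
- apply: contraNneq ci => /polyP /(_ i); rewrite coef_poly ltn_ord inord_val coef0 => ->.
  by [].
Qed.

(** * Monic equations for polynomial values on a root of h *)

Section IntegralValues.
Variables (K : fieldType) (V : subringClosed K) (pi : K) (n : nat).
Hypothesis Vpi : dvr_uniformizer V pi.
Local Notation ev kappa f x := (map_poly kappa f).[x].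

Variable f : {poly K}.
Hypothesis fP : forall (L : fieldType) (kappa : {rmorphism K -> L})
  (O : subringClosed L) x, prolongation V pi n kappa O -> x \in O ->
  ev kappa f x \in O.
Variable h : {poly K}.
Hypotheses (hm : h \is monic) (hV : h \is a polyOver V) (hs : size h = n.+1).

(** Otherwise some valuation ring [O] of [L] contains the image of [V] but not f(x). If pi^-1 were
    in [O], so would be the image of [K] and then f(x), which is algebraic over [K]. So [O] prolongs
    [V], it contains x, integral over [V], and [fP] gives a contradiction. *)
Lemma integral_value (L : fieldType) (kappa : {rmorphism K -> L}) (x : L) :
  (forall y, exists p : {poly K},
     [/\ p != 0, (size p <= n.+1)%N & root (map_poly kappa p) y]) ->
  root (map_poly kappa h) x ->
  exists q, [/\ q \is monic, q \is a polyOver V & root (map_poly kappa q) (ev kappa f x)].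
Proof.
move=> Ldeg hx; pose R0p : {pred L} := fun y => `[< exists2 c, c \in V & y = kappa c >].
have R0s : subring_closed R0p.
  split; first by apply/asboolP; exists 1; rewrite ?rpred1 ?rmorph1.
    move=> _ _ /asboolP[a aV ->] /asboolP[b bV ->]; apply/asboolP.
    by exists (a - b); rewrite ?rpredB ?rmorphB.
  move=> _ _ /asboolP[a aV ->] /asboolP[b bV ->]; apply/asboolP.
  by exists (a * b); rewrite ?rpredM ?rmorphM.
pose R0 : subringClosed L := HB.pack R0p (GRing.isSubringClosed.Build L R0p R0s).
have [[p [pm pR pz]]|nint] := pselect (exists p, [/\ p \is monic, p \is a polyOver R0
    & root p (ev kappa f x)]).
  have /fin_all_exists[c cE] (i : 'I_(size p)) : exists c, c \in V /\ p`_i = kappa c.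
    by move/polyOverP: pR => /(_ i) /asboolP[c cV ->]; exists c.
  have [s sE] : exists s, size p = s.+1.
    by exists (size p).-1; rewrite prednK // size_poly_gt0 monic_neq0.
  pose q : {poly K} := \poly_(i < size p) (oapp c 0 (insub i)).
  have qE : map_poly kappa q = p.
    apply/polyP => i; rewrite coef_map coef_poly.
    case: ltnP => ip; last by rewrite /= rmorph0 nth_default.
    by rewrite insubT /=; exact: (esym (cE (Ordinal ip)).2).
  exists q; rewrite qE; split=> //.
    by rewrite -(map_monic kappa) qE.
  apply/polyOver_poly => i ip; rewrite insubT /=; exact: (cE _).1.
have [O [Oval RO zO]] := valuation_ring_avoiding nint.
have VO c : c \in V -> kappa c \in O by move=> cV; apply/RO/asboolP; exists c.
have mapO q : q \is a polyOver V -> map_poly kappa q \is a polyOver O.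
  by move=> /polyOverP qV; apply/polyOverP => i; rewrite coef_map VO.
exfalso; move/negP: (zO); apply; apply: fP; last first.
  by apply: (val_ring_integral Oval _ (mapO _ hV) hx); rewrite map_monic.
split=> //; apply/negP => piO; case: (Vpi) => pi0 piV _ dec.
have KO c : kappa c \in O.
  have [->|c0] := eqVneq c 0; first by rewrite rmorph0 rpred0.
  have [l [u [uV _ ->]]] := dec c c0; rewrite rmorphM /= fmorphXz rpredM ?VO //.
  by case: l => l; rewrite ?NegzE -?exprnN -?exprVn ?rpredX // VO.
have [p [p0 _ pz]] := Ldeg (ev kappa f x).
move/negP: zO; apply; apply: (@val_ring_integral _ _ Oval (map_poly kappa ((lead_coef p)^-1 *: p))).
- by rewrite map_monic monicE lead_coefZ mulVf ?lead_coef_eq0.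
- by apply/polyOverP => i; rewrite coef_map KO.
- by rewrite map_polyZ rootZ // fmorph_eq0 invr_eq0 lead_coef_eq0.
Qed.

(** Work in the field [L] generated by a root x of [p]: f(x) has degree at most [L : K] = deg p, and
    q(f(x)) = 0 says that [p] divides the composite. *)
Lemma integral_value_irreducible (p : {poly K}) : irreducible_poly p -> p %| h ->
  exists q, [/\ q \is monic, q \is a polyOver V, (size q <= size p)%N & p %| q \Po f].
Proof.
move=> pirr ph; have h0 := monic_neq0 hm.
have [L dL [x px _]] := irredp_FAdjoin pirr.
have sp : (\dim {:L}).+1 = size p.
  by rewrite dL prednK // size_poly_gt0; apply: irredp_neq0.
have [||q [qm qV qz]] := @integral_value L (in_alg L) x.
- move=> y; have [q [q0 sq qy]] := fieldext_annihilator y; exists q; split=> //.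
  by rewrite -hs (leq_trans sq) // sp dvdp_leq.
- by move/dvdpP: ph => [e ->]; rewrite rmorphM rootM px orbT.
have [q' [q'0 sq' q'z]] := fieldext_annihilator (ev (in_alg L) f x).
have [m [mm mV sm mz]] :=
  integral_small_degree (uniformizer_valuation_ring Vpi) q'0 q'z qm qV qz.
exists m; split=> //; first by rewrite (leq_trans sm) // -sp.
apply: (irreducible_dvd_root pirr px).
by rewrite /root map_comp_poly horner_comp.
Qed.

(** Induction on the degree: a reducible [p] is split into two factors and the polynomials found for
    them are multiplied. Degrees add up, and repeated factors are counted with multiplicity. *)
Lemma integral_value_dvd (p : {poly K}) : p %| h ->
  exists q, [/\ q \is monic, q \is a polyOver V, (size q <= size p)%N & p %| q \Po f].
Proof.
have [m sm] := ubnP (size p); elim: m p sm => // m IH p sm ph.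
have p0 : p != 0 by apply: contraTneq ph => ->; rewrite dvd0p monic_neq0.
have [pirr|nirr] := pselect (irreducible_poly p); first exact: integral_value_irreducible.
have [sp|sp] := leqP (size p) 1.
  exists 1; rewrite monic1 rpred1 size_poly1 size_poly_gt0 p0 rmorph1; split=> //.
  have /size_poly1P[c c0 ->] : size p == 1%N by rewrite eqn_leq sp size_poly_gt0.
  by apply/dvdpP; exists (c^-1)%:P; rewrite -polyCM mulVf.
have [q [sq qp nqp]] : exists q : {poly K}, [/\ size q != 1%N, q %| p & ~~ (q %= p)].
  apply/not_existsP => hq; apply: nirr; split=> // q sq qp.
  by apply/negPn/negP => nqp; apply: (hq q).
have q0 : q != 0 by apply: contraTneq qp => ->; rewrite dvd0p.
have sqp : (size q < size p)%N.
  by rewrite ltn_neqAle dvdp_leq // andbT (dvdp_size_eqp qp).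
move/dvdpP: (qp) => [r pE].
have r0 : r != 0 by apply: contraNneq p0 => r0; rewrite pE r0 mul0r.
have sq1 : (1 < size q)%N by rewrite ltn_neqAle eq_sym sq size_poly_gt0.
have spE : size p = (size r + size q).-1 by rewrite pE size_mul.
have [||a [am aV sa qa]] := IH q.
- by rewrite (leq_trans sqp).
- exact: dvdp_trans qp ph.
have [||b [bm bV sb rb]] := IH r.
- apply: leq_trans (_ : size p <= m)%N; last by rewrite -ltnS.
  by rewrite spE; move: sq1; case: (size q) => [|[|s]] // _; rewrite !addnS /= ltnS leq_addr.
- by apply: dvdp_trans ph; rewrite pE dvdp_mulr.
exists (b * a); split.
- by rewrite monicMl.
- exact: rpredM.
- by rewrite spE size_mul ?monic_neq0 // -!subn1 leq_sub2r // leq_add //.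
- by rewrite pE rmorphM dvdp_mul.
Qed.

(** Padding by a power of X makes the degree exactly [n], so that the reductions modulo [pi] form a
    finite family. *)
Lemma integral_value_monic :
  exists q, [/\ q \is monic, q \is a polyOver V, size q = n.+1 & h %| q \Po f].
Proof.
have [q [qm qV sq hq]] := integral_value_dvd (dvdpp h).
exists (q * 'X^(n.+1 - size q)); split.
- by rewrite monicMl ?monicXn.
- by rewrite rpredM ?rpredX ?polyOverX.
- by rewrite size_Mmonic ?monicXn ?monic_neq0 // size_polyXn addnS /= subnKC // -hs.
- by rewrite comp_polyM dvdp_mulr.
Qed.

End IntegralValues.

(** * Polynomials with integral values *)

Lemma uniformizer_clear_denominators (K : fieldType) (V : subringClosed K) (pi : K)
    (p : {poly K}) : dvr_uniformizer V pi ->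
  exists k : nat, pi ^+ k *: p \is a polyOver V.
Proof.
case=> pi0 piV _ dec; elim/poly_ind: p => [|p c [k kV]].
  by exists 0%N; rewrite scaler0 rpred0.
have [l lV] : exists l : nat, pi ^+ l * c \in V.
  have [->|c0] := eqVneq c 0; first by exists 0%N; rewrite mulr0 rpred0.
  have [l [u [uV _ ->]]] := dec c c0; case: l => l.
    by exists 0%N; rewrite mul1r rpredM // -exprnP rpredX.
  by exists l.+1; rewrite NegzE -exprnN mulVKf ?expf_neq0.
exists (k + l)%N; rewrite scalerDr rpredD //.
  rewrite scalerAl addnC exprD -scalerA rpredM ?polyOverX // polyOverZ ?rpredX //.
by rewrite exprD -scalerA -!mul_polyC -polyCM rpredM ?polyOverC ?rpredX.
Qed.

(** The determinant trick for left multiplication by [b]: p(b) acts on the [G i] through p(C), so by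
    Cayley-Hamilton the characteristic polynomial kills each [G i], hence 1, which they span. *)
Lemma charpoly_annihilates (K : fieldType) (B : algType K) (b : B) n
    (G : 'I_n -> B) (C : 'M[K]_n) (e : 'I_n -> K) :
  1 = \sum_i e i *: G i -> (forall i, b * G i = \sum_j C i j *: G j) ->
  horner_alg b (char_poly C) = 0.
Proof.
case: n G C e => [|n] G C e one_span bG.
  by move: one_span; rewrite big_ord0 => /eqP; rewrite oner_eq0.
have act p i : horner_alg b p * G i = \sum_j (horner_mx C p) i j *: G j.
  elim/poly_ind: p i => [|p c IH] i.
    by rewrite !rmorph0 mul0r big1 // => j _; rewrite mxE scale0r.
  rewrite rmorphD rmorphM /= horner_algX horner_algC mulrDl -mulrA bG.
  rewrite [p * 'X]mulrC rmorphD rmorphM /= horner_mx_X horner_mx_C mulr_algl.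
  under [RHS]eq_bigr do rewrite !mxE scalerDl.
  rewrite big_split /=; congr (_ + _); last first.
    rewrite (bigD1 i) //= eqxx mulr1n big1 ?addr0 // => j ji.
    by rewrite eq_sym (negPf ji) mulr0n scale0r.
  rewrite [LHS]mulr_sumr; under [LHS]eq_bigr do rewrite -scalerAr IH scaler_sumr.
  rewrite exchange_big /=; apply: eq_bigr => j _; rewrite scaler_suml.
  by apply: eq_bigr => k _; rewrite scalerA.
rewrite -[LHS]mulr1 one_span mulr_sumr big1 // => i _.
rewrite -scalerAr act Cayley_Hamilton big1 ?scaler0 // => j _.
by rewrite mxE scale0r.
Qed.

(** * Integrality over the integer-valued polynomials of the local algebra *)

Section IntegralOverLocal.
Variables (K : fieldType) (V : subringClosed K) (pi : K) (n : nat) (reps : seq K).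
Hypotheses (Vpi : dvr_uniformizer V pi) (hreps : residue_system V pi reps).
Variables (B : algType K) (S : set B).
Hypotheses (S1 : S 1) (SD : forall x y, S x -> S y -> S (x + y))
  (SM : forall x y, S x -> S y -> S (x * y))
  (SZ : forall c x, c \in V -> S x -> S (c *: x)).

Lemma horner_alg_closed b p : S b -> p \is a polyOver V -> S (horner_alg b p).
Proof.
move=> Sb; elim/poly_ind: p => [|p c IH] pV.
  by rewrite rmorph0 -(scale0r 1); apply: SZ => //; rewrite rpred0.
rewrite rmorphD rmorphM /= horner_algX horner_algC.
apply: SD; [apply: SM => //; apply: IH|apply: SZ => //].
  apply/polyOverP => i; move/polyOverP: pV => /(_ i.+1).
  by rewrite coefD coefMX coefC addr0.
by move/polyOverP: pV => /(_ 0%N); rewrite coefD coefMX coefC add0r.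
Qed.

(** As [c] varies, these finitely many polynomials represent all monic polynomials of degree [n]
    over the residue field. *)
Definition monic_of (c : {ffun 'I_n -> 'I_(size reps)}) : {poly K} :=
  'X^n + \poly_(i < n) (oapp (fun j => reps`_(c j)) 0 (insub i)).

Lemma monic_of_monic c : monic_of c \is monic.
Proof. by rewrite monicE lead_coefDl ?lead_coefXn // size_polyXn ltnS size_poly. Qed.

Lemma monic_of_polyOver c : monic_of c \is a polyOver V.
Proof.
rewrite rpredD ?rpredX ?polyOverX //; apply/polyOver_poly => i ilt.
by rewrite insubT /=; apply: hreps.1; rewrite mem_nth.
Qed.

Lemma monic_of_approx (psi : {poly K}) : psi \is monic -> psi \is a polyOver V ->
  size psi = n.+1 -> exists c r, r \is a polyOver V /\ monic_of c = psi + pi *: r.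
Proof.
move=> pm pV sp; have pi0 : pi != 0 by case: Vpi.
have /fin_all_exists[c hc] (i : 'I_n) :
    exists a : 'I_(size reps), (psi`_i - reps`_a) / pi \in V.
  have pV' : psi`_i \in V by move/polyOverP: pV.
  have [b br hb] := hreps.2 _ pV'.
  have bq : (index b reps < size reps)%N by rewrite index_mem.
  by exists (Ordinal bq); rewrite /= nth_index.
pose c' := [ffun i => c i].
exists c', (pi^-1 *: (monic_of c' - psi)); split; last first.
  by rewrite scalerA divff // scale1r addrC subrK.
apply/polyOverP => i; rewrite coefZ coefB coefD coefXn coef_poly.
have psi_n : psi`_n = 1 by have := monicP pm; rewrite lead_coefE sp.
case: (ltngtP i n) => [ilt|ilt|->].
- rewrite insubT /= ffunE add0r mulrC -rpredN -mulNr opprB.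
  exact: (hc (Ordinal ilt)).
- by rewrite addr0 sub0r nth_default ?sp // oppr0 mulr0 rpred0.
- by rewrite psi_n addr0 subrr mulr0 rpred0.
Qed.

Variable f : {poly K}.
Hypothesis fint : forall b, S b -> exists psi : {poly K},
  [/\ psi \is monic, psi \is a polyOver V, size psi = n.+1
    & horner_alg b (psi \Po f) = 0].

(** Let Phi be X times the product of all [monic_of c]. For b in [S], the equation psi of f(b) is
    congruent to a factor of Phi modulo pi, so Phi(f(b)) is pi times a polynomial in f(b). Its power
    N + 1 gains pi^(N+1), and reduction modulo psi leaves powers f^i with i < n, whose denominators
    pi^N clears. *)
Lemma integral_over_IntK : exists phi : {poly K},
  [/\ phi \is monic, phi \is a polyOver V, (1 < size phi)%N & IntK S (phi \Po f)].
Proof.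
have [pi0 piV] : pi != 0 /\ pi \in V by case: Vpi.
have [k kV] := uniformizer_clear_denominators f Vpi.
pose N := (k * n)%N.
have fV i : (i < n)%N -> pi ^+ N *: f ^+ i \is a polyOver V.
  move=> ilt; have -> : pi ^+ N *: f ^+ i = pi ^+ (k * (n - i)) *: (pi ^+ k *: f) ^+ i.
    by rewrite exprZn -exprM scalerA -exprD -mulnDr subnK // ltnW.
  by rewrite polyOverZ ?rpredX.
(* The factor X makes Phi nonconstant without a case distinction. *)
pose Phi := 'X * \prod_c monic_of c.
have Phim : Phi \is monic.
  by rewrite monicMl ?monicX // monic_prod // => c _; exact: monic_of_monic.
have PhiV : Phi \is a polyOver V.
  by rewrite rpredM ?polyOverX // rpred_prod // => c _; exact: monic_of_polyOver.
exists (Phi ^+ N.+1); split.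
- by rewrite monic_exp.
- by rewrite rpredX.
- have -> : Phi ^+ N.+1 = (\prod_c monic_of c * Phi ^+ N) * 'X by rewrite exprS /Phi; ring.
  rewrite size_mulX ?ltnS ?size_poly_gt0 mulf_neq0 ?expf_neq0 ?monic_neq0 //.
    by rewrite monic_prod // => c _; exact: monic_of_monic.
  by rewrite monic_prod // => c _; exact: monic_of_monic.
move=> b Sb; have [psi [pm pV sp psib]] := fint Sb.
have [c [r [rV cE]]] := monic_of_approx pm pV sp.
pose e p := horner_alg b (p \Po f).
have e0 : e 0 = 0 by rewrite /e comp_poly0 rmorph0.
have eD p q : e (p + q) = e p + e q by rewrite /e comp_polyD rmorphD.
have eM p q : e (p * q) = e p * e q by rewrite /e comp_polyM rmorphM.
have eX p m : e (p ^+ m) = e p ^+ m by rewrite /e rmorphXn /= rmorphXn.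
have eZ a p : e (a *: p) = a *: e p by rewrite /e comp_polyZ linearZ /= mulr_algl.
pose s := 'X * \prod_(d | d != c) monic_of d.
have sV : s \is a polyOver V.
  by rewrite rpredM ?polyOverX // rpred_prod // => d _; exact: monic_of_polyOver.
have PhiE : Phi = psi * s + pi *: (r * s).
  by rewrite /Phi (bigD1 c) //= cE /s -!mul_polyC; ring.
have ePhi : e Phi = pi *: e (r * s) by rewrite PhiE eD eM {1}/e psib mul0r add0r eZ.
have [t [rho [tV rhoV srho tE]]] :=
  monic_reduction pm pV sp (rpredX N.+1 (rpredM rV sV)).
have -> : horner_alg b (Phi ^+ N.+1 \Po f) =
    pi *: \sum_(i < n) rho`_i *: horner_alg b (pi ^+ N *: f ^+ i).
  rewrite -/(e _) eX ePhi exprZn -eX tE eD eM {2}/e psib mulr0 add0r.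
  rewrite exprS -scalerA; congr (_ *: _).
  have rhoE : rho = \sum_(i < n) rho`_i *: 'X^i.
    apply/polyP => i; rewrite -poly_def coef_poly; case: ltnP => // ni.
    by rewrite nth_default // (leq_trans srho).
  rewrite {1}rhoE (big_morph e eD e0) scaler_sumr; apply: eq_bigr => i _.
  have -> : horner_alg b (pi ^+ N *: f ^+ i) = pi ^+ N *: e 'X^i.
    by rewrite -eZ /e comp_polyZ comp_Xn_poly.
  by rewrite eZ !scalerA mulrC.
apply: SZ => //; elim/big_ind: _ => //.
  by rewrite -(scale0r 1); apply: SZ => //; rewrite rpred0.
move=> i _; apply: SZ; first by move/polyOverP: rhoV.
by apply: horner_alg_closed => //; exact: fV.
Qed.

End IntegralOverLocal.

(** * Localization at a maximal ideal *)

Lemma fraction_num_den (D : idomainType) (x : {fraction D}) :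
  exists a b : D, b != 0 /\ x = a%:F / b%:F.
Proof.
elim/quotW: x => r; exists \n_r, \d_r; have d0 := denom_ratioP r; split=> //.
have d0' : (\d_r)%:F != 0 :> {fraction D} by rewrite tofrac_eq0.
apply: (mulIf d0'); rewrite divfK //.
rewrite !piE; apply/eqmodP; rewrite /= FracField.equivfE.
by rewrite /FracField.mulf !numden_Ratio ?mulf_neq0 ?oner_eq0 // !mulr1 mulrC.
Qed.

Section MaximalIdeals.
Variable D : idomainType.

(** Zorn's lemma on the proper ideals containing [I]. The result is packaged as a [prime_idealr],
    the type over which the localization hypothesis ranges; the last clause gives inverses modulo
    [M]. *)
Lemma exists_maximal_ideal (I : set D) : I 0 ->
  (forall x y, I x -> I y -> I (x - y)) -> (forall a x, I x -> I (a * x)) -> ~ I 1 ->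
  exists M : prime_idealr D, [/\ maximal_ideal M, forall x, I x -> x \in M
    & forall s, s \notin M -> exists t, 1 - t * s \in M].
Proof.
move=> I0 IB IM I1.
pose sub (A : set D) := [/\ I `<=` A, forall x y, A x -> A y -> A (x - y),
  forall a x, A x -> A (a * x) & ~ A 1].
have [|A [PA Amax]] := @Zorn_bigcup D (fun A => A = set0 \/ sub A).
  move=> F FP Ftot.
  have [[X0 [FX0 sX0]]|Fn] := pselect (exists X, F X /\ sub X); last first.
    left; rewrite -subset0 => x [X FX Xx].
    by case: (FP X FX) => [X0|sX]; [rewrite X0 in Xx|apply: Fn; exists X].
  have sF X x : F X -> X x -> sub X.
    by move=> FX Xx; case: (FP X FX) => // X0'; rewrite X0' in Xx.
  right; split.
  - by move=> x Ix; exists X0 => //; case: sX0 => /(_ x Ix).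
  - move=> x y [X FX Xx] [Y FY Yy].
    case: (Ftot X Y FX FY) => [XY|YX].
      by exists Y => //; case: (sF _ _ FY Yy) => _ h _ _; apply: h => //; exact: XY.
    by exists X => //; case: (sF _ _ FX Xx) => _ h _ _; apply: h => //; exact: YX.
  - move=> a x [X FX Xx].
    by exists X => //; case: (sF _ _ FX Xx) => _ _ h _; apply: h.
  - by move=> [X FX Xz]; case: (sF _ _ FX Xz).
have sA : sub A.
  case: PA => // A0'; exfalso; apply: (Amax I); last by right; split.
  by split; rewrite ?A0' // => /(_ 0 I0).
case: (sA) => IA AB AM A1; have A0 : A 0 by apply: IA.
have inv s : ~ A s -> exists t, A (1 - t * s).
  move=> As; have [//|nt] := pselect (exists t, A (1 - t * s)); exfalso.
  pose C : set D := [set x | exists t, A (x - t * s)].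
  have AC : A `<=` C by move=> x Ax; exists 0; rewrite mul0r subr0.
  apply: (Amax C); first split=> // CA.
    by apply/As/CA; exists 1; rewrite mul1r subrr.
  right; split=> //.
  - exact: subset_trans AC.
  - move=> x y [t tA] [u uA]; exists (t - u).
    by have := AB _ _ tA uA; congr A; ring.
  - move=> a x [t tA]; exists (a * t).
    by have := AM a _ tA; congr A; ring.
pose Mp : {pred D} := fun x => `[< A x >].
have Mid : idealr_closed Mp.
  split; [exact/asboolP|exact/asboolP|].
  move=> a x y /asboolP Ax /asboolP Ay; apply/asboolP.
  rewrite -[y]opprK; apply: (AB); first exact: AM.
  by rewrite -sub0r; apply: (AB).
(* If 1 - t u lies in the ideal, so does v = v (1 - t u) + t (u v). *)
have Mpr : prime_idealr_closed Mp.
  move=> u v /asboolP Auv; apply/orP.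
  have [Au|Au] := pselect (A u); [by left; exact/asboolP|right; apply/asboolP].
  have [t tA] := inv u Au.
  have := AB _ _ (AM v _ tA) (AM (- t) _ Auv).
  by congr A; ring.
pose M0 : idealr D := HB.pack Mp (isIdealr.Build D Mp Mid).
pose M : prime_idealr D := HB.pack Mp (isIdealr.Build D Mp Mid)
  (isPrimeIdealrClosed.Build D Mp Mpr).
have ME x : (x \in M) <-> A x by split=> [/asboolP|Ax]; last exact/asboolP.
exists M; split.
- move=> J MJ x xJ; apply/negPn/negP => xM.
  apply: (Amax [set y | y \in J]).
    split=> [y /ME /MJ //|h]; move/negP: xM; apply; apply/ME; exact: h.
  right; split.
  + by move=> y /IA /ME /MJ.
  + by move=> y z /=; exact: rpredB.
  + by move=> a y /=; exact: idealMr.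
  + by rewrite /= idealr1.
- by move=> x /IA /ME.
- move=> s sM; have [|t tA] := inv s; first by move=> /ME; exact/negP.
  by exists t; apply/ME.
Qed.

End MaximalIdeals.

(** * The discrete valuation ring of a normalized valuation *)

Section NormalizedValuation.
Variables (K : fieldType) (v : K -> int).
Hypothesis hv : normalized_valuation v.

Lemma norm_valM x y : x != 0 -> y != 0 -> v (x * y) = v x + v y.
Proof. by case: hv => h _ _; exact: h. Qed.

Lemma norm_val1 : v 1 = 0.
Proof.
by have := norm_valM (oner_neq0 K) (oner_neq0 K); rewrite mulr1; move: (v 1) => a; lia.
Qed.

Lemma norm_valV x : x != 0 -> v x^-1 = - v x.
Proof.
move=> x0; have xV0 : x^-1 != 0 by rewrite invr_eq0.
by have := norm_valM x0 xV0; rewrite divff // norm_val1; move: (v x) (v x^-1) => a b; lia.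
Qed.

Lemma norm_valX x n : x != 0 -> v (x ^+ n) = v x *+ n.
Proof.
move=> x0; elim: n => [|n IH]; first by rewrite norm_val1.
by rewrite exprS norm_valM ?expf_neq0 // IH mulrS.
Qed.

Lemma norm_valN x : x != 0 -> v (- x) = v x.
Proof.
move=> x0; have n0 : (- x) != 0 by rewrite oppr_eq0.
have := norm_valX 2 n0; rewrite sqrrN norm_valX // !mulr2n; move: (v x) (v (- x)) => a b; lia.
Qed.

Definition val_ring_pred : {pred K} := fun x => (x == 0) || (0 <= v x).

Lemma val_ring_pred_subring : subring_closed val_ring_pred.
Proof.
split; first by rewrite unfold_in norm_val1 lexx orbT.
- move=> x y; rewrite !unfold_in.
  have [->|x0] := eqVneq x 0.
    by rewrite sub0r oppr_eq0; case: eqVneq => //= y0; rewrite norm_valN.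
  have [->|y0] := eqVneq y 0; first by rewrite subr0 (negPf x0).
  case: eqVneq => //= xy vx vy.
  case: hv => _ /(_ x (- y)) h _; move: h; rewrite oppr_eq0 norm_valN // => /(_ x0 y0 xy).
  by apply: le_trans; rewrite le_min vx vy.
- move=> x y; rewrite !unfold_in mulf_eq0.
  have [->|x0] := eqVneq x 0 => //=.
  have [->|y0] := eqVneq y 0 => //=.
  by move=> vx vy; rewrite norm_valM // addr_ge0.
Qed.

Lemma val_ring_pred_uniformizer pi : pi != 0 -> v pi = 1 ->
  dvr_uniformizer val_ring_pred pi.
Proof.
move=> pi0 vpi; split=> //.
- by rewrite unfold_in vpi orbT.
- by rewrite unfold_in invr_eq0 (negPf pi0) norm_valV // vpi.
move=> x x0; exists (v x), (x / pi ^ v x).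
have p0 l : pi ^ l != 0 by rewrite expfz_neq0.
have vp l : v (pi ^ l) = l.
  case: l => l; first by rewrite -exprnP norm_valX // vpi natz.
  by rewrite NegzE -exprnN norm_valV ?expf_neq0 // norm_valX // vpi natz.
have vu : v (x / pi ^ v x) = 0.
  by rewrite norm_valM ?invr_eq0 // norm_valV // vp subrr.
split; last by rewrite mulrC divfK.
- by rewrite unfold_in vu lexx orbT.
- by rewrite unfold_in norm_valV ?mulf_neq0 ?invr_eq0 // vu oppr0 lexx orbT.
Qed.

End NormalizedValuation.

(** Representatives of D/M also represent the residue field of the localization: d/s is congruent to
    d t, where t inverts s modulo [M]. *)
Lemma local_ring_dvr (D : idomainType) (M : prime_idealr D) :
  almost_dedekind D -> finite_residue_fields D -> maximal_ideal M ->
  (forall s, s \notin M -> exists t, 1 - t * s \in M) ->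
  exists (V : subringClosed {fraction D}) pi reps,
    [/\ dvr_uniformizer V pi, residue_system V pi reps
      & forall x, x \in V <-> exists s d : D, s \notin M /\ x = d%:F / s%:F].
Proof.
move=> [_ hdvr] hfin Mmax Minv.
have [v hv VE] := hdvr M Mmax.
have [pi pi0 vpi] : exists2 x, x != 0 & v x = 1 by case: hv.
pose V : subringClosed {fraction D} := HB.pack (val_ring_pred v)
  (GRing.isSubringClosed.Build {fraction D} (val_ring_pred v) (val_ring_pred_subring hv)).
have Vpi : dvr_uniformizer V pi := val_ring_pred_uniformizer hv pi0 vpi.
have VE' x : x \in V <-> exists s d : D, s \notin M /\ x = d%:F / s%:F.
  have -> : (x \in V) <-> local_ring M x.
    rewrite VE; split=> [/orP[/eqP|]|[->|h]]; [by left|by right| |].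
      by rewrite rpred0.
    by apply/orP; right.
  split=> [[s [m [sM [d _ <-] ->]]]|[s [d [sM ->]]]].
    by exists s, d; split=> //; rewrite /GRing.scale /= mulrC.
  by exists s, (d%:F); split; [|exists d|rewrite /GRing.scale /= mulrC].
have /finite_seqP[qs qsE] := hfin M Mmax.
have notM0 s : s \notin M -> s%:F != 0 :> {fraction D}.
  by move=> sM; rewrite tofrac_eq0; apply: contraNneq sM => ->; rewrite rpred0.
(* If the inverse of [d] were e/s with s outside [M], then s = e d would lie in [M]. *)
have MV d : d \in M -> d%:F / pi \in V.
  move=> dM; apply: (uniformizer_dvd Vpi); rewrite max_idealE.
  case: eqVneq => //= d0; apply/negP => /VE'[s [e [sM dE]]].
  move/negP: (sM); apply.
  have : e * d = s.
    apply/eqP; rewrite -tofrac_eq rmorphM /=; apply/eqP.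
    by apply: (mulIf (invr_neq0 d0)); rewrite mulfK // dE mulrCA mulfV ?mulr1 // notM0.
  by move=> <-; rewrite idealMr.
exists V, pi, [seq (repr y)%:F | y <- qs]; split=> //; split.
  move=> _ /mapP[y _ ->]; apply/VE'; exists 1, (repr y).
  by rewrite idealr1 rmorph1 divr1.
move=> x /VE'[s [d [sM ->]]]; have [t tM] := Minv s sM.
pose y : {ideal_quot M} := (\pi_{ideal_quot M} (d * t))%qT.
exists (repr y)%:F; first by apply/mapP; exists y => //; have : [set` qs] y by rewrite -qsE.
have yM : d * t - repr y \in M by rewrite Quotient.idealrBE reprK.
have -> : d%:F / s%:F - (repr y)%:F =
   (d * t - repr y)%:F + (d * (1 - t * s))%:F / s%:F.
  by rewrite !(rmorphB, rmorphM, rmorph1) /=; field; rewrite notM0.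
rewrite mulrDl rpredD ?MV // mulrAC rpredM //.
  by apply: MV; rewrite idealMr.
by apply/VE'; exists s, 1; rewrite rmorph1 mul1r.
Qed.

(** * The ring Int_K(A) *)

Lemma uniformizer_clear_family (K : fieldType) (V : subringClosed K) (pi : K)
    (F : nat -> {poly K}) r : dvr_uniformizer V pi ->
  exists k : nat, forall i, (i <= r)%N -> pi ^+ k *: F i \is a polyOver V.
Proof.
move=> Vpi; have piV : pi \in V by case: Vpi.
elim: r => [|r [k kV]].
  have [k kV] := uniformizer_clear_denominators (F 0%N) Vpi.
  by exists k => i; rewrite leqn0 => /eqP->.
have [l lV] := uniformizer_clear_denominators (F r.+1) Vpi.
exists (k + l)%N => i; rewrite leq_eqVlt => /orP[/eqP->|ir].
  by rewrite exprD -scalerA polyOverZ // rpredX.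
by rewrite addnC exprD -scalerA polyOverZ ?rpredX // kV.
Qed.

(** Multiply the individual multipliers; primality keeps the product outside [M]. *)
Lemma common_multiplier (D : idomainType) (M : prime_idealr D)
    (P : nat -> D -> Prop) r :
  (forall i s t, P i s -> P i (t * s)) ->
  (forall i, (i < r)%N -> exists2 s, s \notin M & P i s) ->
  exists2 s, s \notin M & forall i, (i < r)%N -> P i s.
Proof.
move=> PM; elim: r => [|r IH] Pr; first by exists 1 => //; rewrite idealr1.
have [|s sM sP] := IH; first by move=> i ir; apply: Pr; rewrite ltnW.
have [t tM tP] := Pr r (ltnSn r).
exists (s * t); first by rewrite prime_idealrM negb_or sM.
move=> i; rewrite ltnS leq_eqVlt => /orP[/eqP->|ir]; first exact: PM.
by rewrite mulrC; apply/PM/sP.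
Qed.

Lemma Bezout_family (K : fieldType) (F : nat -> {poly K}) r :
  exists d (a : nat -> {poly K}), (forall i, (i <= r)%N -> d %| F i) /\
    d = \sum_(i < r.+1) a i * F i.
Proof.
elim: r => [|r [d [a [dF dE]]]].
  exists (F 0%N), (fun=> 1); rewrite big_ord1 mul1r; split=> // i.
  by rewrite leqn0 => /eqP->.
have [[u v] /= uv] := Bezoutp d (F r.+1).
exists (u * d + v * F r.+1), (fun i => if (i <= r)%N then u * a i else v).
split=> [i|]; last first.
  rewrite big_ord_recr /= ltnn dE mulr_sumr; congr (_ + _).
  by apply: eq_bigr => i _; rewrite -ltnS ltn_ord mulrA.
rewrite (eqp_dvdl _ uv) leq_eqVlt => /orP[/eqP->|ir]; first exact: dvdp_gcdr.
exact: dvdp_trans (dvdp_gcdl _ _) (dF _ ir).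
Qed.

Section IntKRing.
Variables (D : idomainType) (A : algType D) (B : algType {fraction D}).
Variable iota : {rmorphism A -> B}.
Hypothesis hB : is_scalar_localization iota.
Local Notation K := {fraction D}.
Local Notation Int := (IntK_pred iota).

Lemma iotaZ d a : iota (d *: a) = d%:F *: iota a.
Proof. by case: hB => h _ _; exact: h. Qed.

Lemma mem_Int f : f \in Int <-> IntK (range iota) f.
Proof. by split=> [/set_mem|h]; last exact: mem_set. Qed.

Lemma Int_const (d : D) : (d%:F)%:P \in Int.
Proof.
apply/IntK_predP => a; exists (d *: 1).
by rewrite iotaZ rmorph1 horner_algC.
Qed.

Lemma Int_X : 'X \in Int.
Proof. by apply/IntK_predP => a; exists a; rewrite horner_algX. Qed.

Lemma Int_scale (d : D) f : f \in Int -> d%:F *: f \in Int.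
Proof. by move=> fI; rewrite -mul_polyC rpredM ?Int_const. Qed.

Lemma Int_clear_denominators (f : {poly K}) :
  exists2 d : D, d != 0 & d%:F *: f \in Int.
Proof.
elim/poly_ind: f => [|p c [d d0 dp]].
  by exists 1; rewrite ?oner_eq0 // scaler0 rpred0.
have [a [b [b0 cE]]] := fraction_num_den c.
have b0' : b%:F != 0 :> K by rewrite tofrac_eq0.
exists (d * b); first by rewrite mulf_neq0.
rewrite scalerDr rpredD //.
  by rewrite scalerAl [d * b]mulrC rmorphM /= -scalerA rpredM ?Int_X // Int_scale.
rewrite -mul_polyC -polyCM tofracM -mulrA cE [b%:F * _]mulrC divfK // -tofracM.
exact: Int_const.
Qed.

Hypothesis hic : integrally_closed (IntK_ring iota).

(** [hic] speaks of the fraction field of the ring [IntK_ring iota], so [f] is written there as the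
    quotient of [d f] by a constant [d], and its equation is transported. *)
Lemma Int_integral (q : {poly {poly K}}) (f : {poly K}) :
  q \is monic -> q \is a polyOver Int -> q.[f] = 0 -> f \in Int.
Proof.
move=> qm /polyOverP qI qf; pose R := IntK_ring iota.
pose toR : {poly K} -> R := insubd (0 : R).
have toRK g : g \in Int -> val (toR g) = g by move=> gI; rewrite val_insubd gI.
have toR0 : toR 0 = 0 by apply: val_inj; rewrite toRK ?rpred0.
pose p : {poly R} := map_poly toR q.
have pE i : val p`_i = q`_i by rewrite coef_map_id0 // toRK.
have lp : toR q`_(size q).-1 = 1.
  by apply: val_inj; rewrite toRK // -lead_coefE (monicP qm) rmorph1.
have sp : size p = size q by rewrite size_poly_eq // lp oner_eq0.
have pm : p \is monic by rewrite monicE lead_coefE sp coef_map_id0 // lp.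
have [d d0 dI] := Int_clear_denominators f.
pose x : {fraction R} := (toR (d%:F *: f))%:F / (toR (d%:F)%:P)%:F.
have dR0 : toR (d%:F)%:P != 0.
  by rewrite -(inj_eq val_inj) toRK ?Int_const // polyC_eq0 tofrac_eq0.
have dR0' : (toR (d%:F)%:P)%:F != 0 :> {fraction R} by rewrite tofrac_eq0.
have [|r rE] := hic (x := x).
  (* Multiplication by the power [size p] of the denominator brings the equation back to the ring,
     where it is read off in K[X]. *)
  exists p => //; apply/eqP; apply: (mulIf (expf_neq0 (size p) dR0')); rewrite mul0r.
  rewrite (horner_coef_wide (n := size p)) ?size_poly // mulr_suml.
  transitivity ((\sum_(i < size p) p`_i * toR (d%:F *: f) ^+ i
      * toR (d%:F)%:P ^+ (size p - i))%:F : {fraction R}).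
    rewrite rmorph_sum; apply: eq_bigr => i _.
    rewrite coef_map !rmorphM !rmorphXn /= /x expr_div_n -!mulrA; congr (_ * (_ * _)).
    by rewrite expfB_cond ?(negPf dR0') ?(ltnW (ltn_ord i)) // mulrC.
  apply/eqP; rewrite tofrac_eq0; apply/eqP/val_inj.
  rewrite !rmorph_sum /=.
  have -> : \sum_(i < size p) val (p`_i * toR (d%:F *: f) ^+ i * toR (d%:F)%:P ^+ (size p - i))
     = (d%:F)%:P ^+ size p * \sum_(i < size p) q`_i * f ^+ i.
    rewrite mulr_sumr; apply: eq_bigr => i _.
    rewrite !rmorphM !rmorphXn /= pE !toRK ?Int_const // -mul_polyC exprMn.
    have -> : (d%:F)%:P ^+ size p = (d%:F)%:P ^+ i * (d%:F)%:P ^+ (size p - i) :> {poly K}.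
      by rewrite -exprD subnKC // ltnW.
    by rewrite -!mulrA mulrCA; congr (_ * _); rewrite mulrA mulrC.
  by rewrite sp -horner_coef qf mulr0.
have : toR (d%:F *: f) = r * toR (d%:F)%:P.
  by apply/eqP; rewrite -tofrac_eq tofracM -rE divfK.
move=> /(congr1 val); rewrite rmorphM /= !toRK ?Int_const // -mul_polyC mulrC => h.
have -> : f = val r by apply: (mulIf _ h); rewrite polyC_eq0 tofrac_eq0.
exact: valP.
Qed.

End IntKRing.

(** * The local algebra at M and descent to Int_K(A) *)

Section LocalInt.
Variables (D : idomainType) (A : algType D) (B : algType {fraction D}).
Variable iota : {rmorphism A -> B}.
Hypothesis hB : is_scalar_localization iota.
Local Notation K := {fraction D}.
Local Notation Int := (IntK_pred iota).
Variables (M : prime_idealr D) (V : subringClosed K).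
Hypothesis VE : forall x, x \in V <-> exists s d : D, s \notin M /\ x = d%:F / s%:F.
Local Notation S := (localize M (range iota)).

Lemma notin_prime_neq0 s : s \notin M -> s%:F != 0 :> K.
Proof.
by move=> sM; rewrite tofrac_eq0; apply: contraNneq sM => ->; rewrite rpred0.
Qed.

Lemma localizeP b : S b <-> exists s a, s \notin M /\ b = s%:F^-1 *: iota a.
Proof.
split=> [[s [_ [sM [a _ <-] ->]]]|[s [a [sM ->]]]]; first by exists s, a.
by exists s, (iota a); split=> //; exists a.
Qed.

Lemma localize_one : S 1.
Proof.
by apply/localizeP; exists 1, 1; rewrite idealr1 !rmorph1 invr1 scale1r.
Qed.

Lemma localize_add x y : S x -> S y -> S (x + y).
Proof.
move=> /localizeP[s [a [sM ->]]] /localizeP[t [b [tM ->]]]; apply/localizeP.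
have [s0 t0] := (notin_prime_neq0 sM, notin_prime_neq0 tM).
exists (s * t), (t *: a + s *: b); split; first by rewrite prime_idealrM negb_or sM.
rewrite rmorphD !(iotaZ hB) tofracM scalerDr !scalerA invfM.
by rewrite divfK // mulrAC mulVf // mul1r.
Qed.

Lemma localize_mul x y : S x -> S y -> S (x * y).
Proof.
move=> /localizeP[s [a [sM ->]]] /localizeP[t [b [tM ->]]]; apply/localizeP.
exists (s * t), (a * b); split; first by rewrite prime_idealrM negb_or sM.
by rewrite rmorphM tofracM invfM -scalerAl -scalerAr scalerA.
Qed.

Lemma localize_scale c x : c \in V -> S x -> S (c *: x).
Proof.
move=> /VE[s [d [sM ->]]] /localizeP[t [b [tM ->]]]; apply/localizeP.
exists (s * t), (d *: b); split; first by rewrite prime_idealrM negb_or sM.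
by rewrite (iotaZ hB) tofracM !scalerA invfM [in RHS]mulrC mulrA.
Qed.

(** Left multiplication by b = a/s on the generators is given by a matrix over [V]; its
    characteristic polynomial serves. *)
Lemma localize_annihilator n (g : 'I_n -> A) b :
  (forall x, exists c : 'I_n -> D, x = \sum_(i < n) c i *: g i) -> S b ->
  exists h : {poly K}, [/\ h \is monic, h \is a polyOver V, size h = n.+1
    & horner_alg b h = 0].
Proof.
move=> gspan /localizeP[s [a [sM ->]]].
have /fin_all_exists[c cE] i := gspan (a * g i).
have [e eE] := gspan 1.
pose C : 'M[K]_n := \matrix_(i, j) ((c i j)%:F / s%:F).
exists (char_poly C); split.
- exact: char_poly_monic.
- by apply: char_poly_polyOver => i j; rewrite mxE; apply/VE; exists s, (c i j).
- exact: size_char_poly.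
apply: (charpoly_annihilates (G := iota \o g) (e := fun i => (e i)%:F)).
  rewrite -(rmorph1 iota) eE rmorph_sum; apply: eq_bigr => i _; exact: iotaZ.
move=> i; rewrite /= -scalerAl -rmorphM cE rmorph_sum scaler_sumr; apply: eq_bigr => j _.
by rewrite (iotaZ hB) mxE scalerA mulrC.
Qed.

Hypothesis hloc : localize M (IntK (range iota)) = IntK S.
Hypothesis hic : integrally_closed (IntK_ring iota).

(** Let t outside [M] clear the denominators of phi and of phi(f), and let m = deg phi. Then t f is
    a root of t^m phi(Y/t) - t^m phi(f), a monic polynomial in Y over Int_K(A). Since m > 0,
    subtracting the constant leaves the leading term intact. *)
Lemma local_integral (phi f : {poly K}) :
  phi \is monic -> phi \is a polyOver V -> (1 < size phi)%N -> IntK S (phi \Po f) ->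
  exists2 s, s \notin M & s%:F *: f \in Int.
Proof.
move=> pm /polyOverP pV sp; rewrite -hloc => -[s0 [r0 [s0M /mem_Int r0I sE]]].
have [||s sM sP] := @common_multiplier D M
    (fun i s => exists d : D, s%:F * phi`_i = d%:F) (size phi).
- move=> i s t [d dE]; exists (t * d); by rewrite !tofracM -mulrA dE.
- move=> i _; have /VE[s [d [sM ->]]] := pV i; exists s => //; exists d.
  by rewrite mulrC divfK // notin_prime_neq0.
have s00 := notin_prime_neq0 s0M.
pose t := s * s0; have tM : t \notin M by rewrite prime_idealrM negb_or sM.
have tE : t%:F = s%:F * s0%:F :> K by rewrite -tofracM.
clearbody t.
have [e se] : exists e, size phi = e.+2 by exists (size phi).-2; case: (size phi) sp => [|[]].
exists t => //.
pose q1 : {poly {poly K}} := \poly_(i < e.+2) (t%:F ^+ (e.+1 - i) * phi`_i)%:P.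
pose q : {poly {poly K}} := q1 - (t%:F ^+ e.+1 *: (phi \Po f))%:P.
have lq1 : (t%:F ^+ (e.+1 - e.+1) * phi`_e.+1)%:P = 1 :> {poly K}.
  by rewrite subnn mul1r; have := monicP pm; rewrite lead_coefE se => /= ->.
have sq1 : size q1 = e.+2 by rewrite size_poly_eq // lq1 oner_eq0.
apply: (Int_integral hB hic (q := q)).
- rewrite monicE /q lead_coefDl ?size_polyN ?sq1.
    by rewrite lead_coefE sq1 coef_poly ltnSn lq1.
  by rewrite (leq_ltn_trans (size_polyC_leq1 _)).
- apply: rpredB; last first.
    rewrite polyOverC sE scalerA exprSr {2}tE !mulrA mulfK // -tofracXn -tofracM.
    exact: Int_scale.
  apply/polyOver_poly => i; rewrite ltnS leq_eqVlt => /orP[/eqP->|ie].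
    by rewrite lq1 rpred1.
  have [|d dE] := sP i; first by rewrite se ltnW.
  rewrite subSn // exprSr {2}tE -!mulrA [s%:F * _]mulrCA dE.
  by rewrite -tofracXn -!tofracM; exact: Int_const.
rewrite /q hornerD hornerN hornerC horner_poly comp_polyE se scaler_sumr.
apply/eqP; rewrite subr_eq0; apply/eqP/eq_bigr => i _.
rewrite mul_polyC exprZn !scalerA; congr (_ *: _).
by rewrite mulrAC -exprD subnK // -ltnS.
Qed.

End LocalInt.

(** Powers of [pi] bring [F] and [a] over [V], turning the relation into one with right-hand side a
    power of [pi]. The products given by [local_partition] are then integral over Int_K(A) localized
    at [M], and a common multiplier [s] moves them into Int_K(A). *)
Lemma local_Int_partition (D : idomainType) (A : algType D)
    (B : algType {fraction D}) (iota : {rmorphism A -> B})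
    (M : prime_idealr D) (V : subringClosed {fraction D}) (pi : {fraction D})
    (reps : seq {fraction D}) r (F a : nat -> {poly {fraction D}}) :
  is_scalar_localization iota -> finitely_generated A ->
  dvr_uniformizer V pi -> residue_system V pi reps ->
  (forall x, x \in V <-> exists s d : D, s \notin M /\ x = d%:F / s%:F) ->
  localize M (IntK (range iota)) = IntK (localize M (range iota)) ->
  integrally_closed (IntK_ring iota) ->
  \sum_(i < r.+1) a i * F i = 1 ->
  exists (s : D) (Y : nat -> {poly {fraction D}}),
    [/\ s \notin M, \sum_(i < r.+1) Y i * F i = (s%:F)%:P
      & forall i j, (i <= r)%N -> (j <= r)%N -> Y i * F j \in IntK_pred iota].
Proof.
move=> hB [n [g gspan]] Vpi hreps VE hloc hic aF.
have pi0 : pi != 0 by case: Vpi.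
have [k1 F1] := uniformizer_clear_family F r Vpi.
have [k2 a1] := uniformizer_clear_family a r Vpi.
pose F' i := if (i <= r)%N then pi ^+ k1 *: F i else 0.
pose a' i := if (i <= r)%N then pi ^+ k2 *: a i else 0.
have [|||Y [YF YO]] := @local_partition _ V pi n reps Vpi hreps F' a' r (k2 + k1).
- by move=> i; rewrite /F'; case: ifP => [/F1//|_]; rewrite rpred0.
- by move=> i; rewrite /a'; case: ifP => [/a1//|_]; rewrite rpred0.
- transitivity (pi ^+ (k2 + k1) *: \sum_(i < r.+1) a i * F i); last by rewrite aF alg_polyC.
  rewrite scaler_sumr; apply: eq_bigr => i _; rewrite /a' /F' -ltnS ltn_ord.
  by rewrite -scalerAl -scalerAr scalerA -exprD.
have YInt i j : (i <= r)%N -> (j <= r)%N ->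
    exists2 s, s \notin M & s%:F *: (Y i * F' j) \in IntK_pred iota.
  move=> ir jr; have [||||b Sb|phi [pm pV sp pI]] := @integral_over_IntK _ V pi n reps
      Vpi hreps B (localize M (range iota)) _ _ _ _ (Y i * F' j).
  - exact: localize_one.
  - exact: localize_add.
  - exact: localize_mul.
  - exact: localize_scale.
  - have [h [hm hV hs hb]] := localize_annihilator hB VE gspan Sb.
    have [|q [qm qV qs hq]] := integral_value_monic Vpi _ hm hV hs (f := Y i * F' j).
      by move=> L kappa O x hO xO; exact: YO.
    exists q; split=> //; move/dvdpP: hq => [e ->].
    by rewrite rmorphM /= hb mulr0.
  exact: (local_integral hB VE hloc hic pm pV sp pI).
have [||s sM sP] := @common_multiplier D M (fun i s =>
    forall j, (j < r.+1)%N -> s%:F *: (Y i * F' j) \in IntK_pred iota) r.+1.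
- by move=> i s t h j /h jI; rewrite tofracM -scalerA Int_scale.
- move=> i ir; apply: (@common_multiplier D M (fun j s =>
    s%:F *: (Y i * F' j) \in IntK_pred iota)) => [j s t jI|j jr].
    by rewrite tofracM -scalerA Int_scale.
  exact: YInt.
(* The factor pi^k1 undoes the scaling of [F]. *)
exists s, (fun i => (s%:F * pi ^+ k1) *: Y i); split=> // [|i j ir jr].
  rewrite -[RHS]mulr1 -YF mulr_sumr; apply: eq_bigr => i _.
  by rewrite /F' -ltnS ltn_ord mul_polyC -scalerAr scalerA -scalerAl.
have := sP i ir j jr; rewrite /F' jr.
by rewrite -scalerAl -scalerAr scalerA.
Qed.

(** The s in [D] for which the [F i] admit such coefficients with sum s form an ideal. The local
    result shows that no maximal ideal contains it, so it contains 1. *)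
Lemma Int_partition (D : idomainType) (A : algType D)
    (B : algType {fraction D}) (iota : {rmorphism A -> B})
    r (F a : nat -> {poly {fraction D}}) :
  almost_dedekind D -> finite_residue_fields D ->
  is_scalar_localization iota -> finitely_generated A ->
  (forall P : prime_idealr D,
     localize P (IntK (range iota)) = IntK (localize P (range iota))) ->
  integrally_closed (IntK_ring iota) ->
  \sum_(i < r.+1) a i * F i = 1 ->
  exists Y : nat -> {poly {fraction D}}, \sum_(i < r.+1) Y i * F i = 1 /\
    forall i j, (i <= r)%N -> (j <= r)%N -> Y i * F j \in IntK_pred iota.
Proof.
move=> hAD hfin hB hfg hloc hic aF.
pose I : set D := [set s | exists Y : nat -> {poly {fraction D}},
  \sum_(i < r.+1) Y i * F i = (s%:F)%:P /\
  forall i j, (i <= r)%N -> (j <= r)%N -> Y i * F j \in IntK_pred iota].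
have [[Y [YF YI]]|I1] := pselect (I 1); first by exists Y; rewrite YF rmorph1.
have [||||M [Mmax IM Minv]] := @exists_maximal_ideal D I.
- exists (fun=> 0); split=> [|i j _ _]; last by rewrite mul0r rpred0.
  by rewrite tofrac0 polyC0 big1 // => i _; rewrite mul0r.
- move=> x y [Y [YF YI]] [Z [ZF ZI]]; exists (fun i => Y i - Z i); split.
    under eq_bigr do rewrite mulrBl.
    by rewrite sumrB YF ZF tofracB polyCB.
  by move=> i j ir jr; rewrite mulrBl rpredB ?YI ?ZI.
- move=> c x [Y [YF YI]]; exists (fun i => c%:F *: Y i); split.
    under eq_bigr do rewrite -scalerAl.
    by rewrite -scaler_sumr YF tofracM polyCM mul_polyC.
  by move=> i j ir jr; rewrite -scalerAl Int_scale ?YI.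
- exact: I1.
have [V [pi [reps [Vpi hreps VE]]]] := local_ring_dvr hAD hfin Mmax Minv.
have [s [Y [sM YF YI]]] :=
  local_Int_partition hB hfg Vpi hreps VE (hloc M) hic aF.
by move/negP: sM; case; apply: IM; exists Y.
Qed.

(** The inverse is the set of all x with x G_i in [R] for every i; [G i0] is a common denominator
    for it, and it contains the [y i]. *)
Lemma ideal_gen_invertible (R : idomainType) n (G : 'I_n -> R)
    (y : 'I_n -> {fraction R}) (i0 : 'I_n) : G i0 != 0 ->
  (forall i j, range (@FracField.tofrac R) (y i * (G j)%:F)) ->
  \sum_i (G i)%:F * y i = 1 -> invertible_ideal (ideal_gen G).
Proof.
move=> Gi0 yG Gy; set rg := range (@FracField.tofrac R) in yG.
have rgD u v : rg u -> rg v -> rg (u + v).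
  by move=> [x _ <-] [z _ <-]; exists (x + z); rewrite ?tofracD.
have rgM u v : rg u -> rg v -> rg (u * v).
  by move=> [x _ <-] [z _ <-]; exists (x * z); rewrite ?tofracM.
have rg0 : rg 0 by exists 0; rewrite ?tofrac0.
have rgF (u : R) : rg u%:F by exists u.
exists [set x | forall i, rg (x * (G i)%:F)].
  split.
  - by move=> i; rewrite mul0r.
  - by move=> x z hx hz i; rewrite mulrDl; apply: rgD.
  - by move=> u x hx i; rewrite -mulrA; apply: rgM.
  - by exists (G i0) => // x hx; rewrite mulrC; exact: hx.
apply/seteqP; split=> x.
  move=> [m [u [v [uI vJ ->]]]]; apply: (big_ind rg) => // k _.
  have [c ->] := uI k; rewrite rmorph_sum mulr_suml; apply: (big_ind rg) => // i _.
  by rewrite rmorphM /= -mulrA [_ * v k]mulrC; apply: rgM => //; exact: vJ.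
move=> [u _ <-].
exists n, (fun i => (G i)%:F), (fun i => u%:F * y i); split.
- move=> i; exists (fun j => (j == i)%:R).
  rewrite (bigD1 i) //= eqxx mul1r big1 ?addr0 // => j /negPf->.
  by rewrite mul0r.
- by move=> i j; rewrite -mulrA; apply: rgM.
- by under eq_bigr do rewrite mulrCA; rewrite -mulr_sumr Gy mulr1.
Qed.

Theorem theorem1p9 (D : idomainType) (A : algType D)
  (B : algType {fraction D}) (iota : {rmorphism A -> B})
  (hD : ADDB_domain D)
  (htf : torsion_free A) (hfg : finitely_generated A)
  (hB : is_scalar_localization iota)
  (hAK : range iota `&` range (fun k : {fraction D} => k%:A : B)
         = range (fun d : D => d%:F%:A : B))
  (hloc : forall P : prime_idealr D,
     localize P (IntK (range iota)) = IntK (localize P (range iota)))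
  (hic : integrally_closed (IntK_ring iota)) :
  prufer_domain (IntK_ring iota).
Proof.
move=> [|r] G [i0 Gi0]; first by case: i0 Gi0.
case: (hD) => hAD hfin _.
pose R := IntK_ring iota; pose K := {fraction D}.
pose F (i : nat) : {poly K} := oapp (fun j => val (G j)) 0 (insub i).
have FE (i : 'I_r.+1) : F i = val (G i) by rewrite /F valK.
(* Dividing by the gcd in K[X] makes the generators coprime, as the partition of unity requires. *)
have [d [a [dF dE]]] := Bezout_family F r.
have Fi0 : F i0 != 0 by rewrite FE -[0](rmorph0 (val : R -> _)) (inj_eq val_inj).
have i0r : (i0 <= r)%N by rewrite -ltnS.
have d0 : d != 0 by apply: contraTneq (dF _ i0r) => ->; rewrite dvd0p.
pose F' i := F i %/ d.
have F'E i : (i <= r)%N -> F i = F' i * d by move=> ir; rewrite divpK // dF.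
have aF' : \sum_(i < r.+1) a i * F' i = 1.
  apply: (mulIf d0); rewrite mul1r {2}dE mulr_suml; apply: eq_bigr => i _.
  by rewrite -mulrA -F'E // -ltnS.
have [Y [YF YI]] := Int_partition hAD hfin hB hfg hloc hic aF'.
pose toR : {poly K} -> R := insubd (0 : R).
have toRK g : g \in IntK_pred iota -> val (toR g) = g.
  by move=> gI; rewrite val_insubd gI.
have Gi0F : (G i0)%:F != 0 :> {fraction R} by rewrite tofrac_eq0.
(* This is Y_i / d, written with numerator and denominator in Int_K(A), since d is only known to be
   in K[X]. *)
pose y (i : 'I_r.+1) : {fraction R} := (toR (Y i * F' i0))%:F / (G i0)%:F.
have yG i j : y i * (G j)%:F = (toR (Y i * F' j))%:F.
  have [ir jr] : (i <= r)%N /\ (j <= r)%N by split; rewrite -ltnS.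
  apply: (mulIf Gi0F); rewrite mulrAC divfK // -!tofracM; congr (_ %:F).
  apply: val_inj; rewrite !rmorphM /= !toRK ?YI // -!FE !F'E //.
  by rewrite -!mulrA; congr (_ * _); rewrite mulrCA.
apply: (@ideal_gen_invertible R _ G y i0 Gi0) => [i j|].
  by rewrite yG; exists (toR (Y i * F' j)).
under eq_bigr do rewrite mulrC yG.
rewrite -rmorph_sum -[RHS](@tofrac1 R); congr (_ %:F).
apply: val_inj; rewrite rmorph_sum rmorph1 -YF; apply: eq_bigr => i _.
by rewrite /= toRK // YI // -ltnS.
Qed.
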